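(* Let $E\to S^4$ be an $SU(2)$ vector bundle with $c_2(E)=1$ over the standard four-sphere, and let $A^1$ be the instanton on $E$ given in normalized stereographic coordinates by $A^1(x)=\mathrm{Im}\bigl(\frac{\bar x\,dx}{1+|x|^2}\bigr)$. Then the round metric $g_{S^4_a}$ of radius $a>0$ together with $A^1$ is a (i) shrinking coupled soliton if $a^2>\frac18$, (ii) steady coupled soliton if $a^2=\frac18$, (iii) expanding coupled soliton if $a^2<\frac18$. More generally, the rescaled round metrics $g(t)=a^2(t)g_{S^4}$ (with $g_{S^4}$ the unit round metric) together with the (time-independent) instanton $A^1$ satisfy $$\frac{\partial g}{\partial t}=-2\,\mathrm{Ric}+\kappa Z,\qquad \frac{\partial A}{\partial t}=-D^*F$$ if and only if $$\frac{d}{dt}a^2(t)=-6+\frac{3\kappa(t)}{4a^2(t)}.$$ In particular, if $\kappa(t)=\kappa$ is a (positive) constant, then the radius $a(t)$ converges exponentially fast to $\sqrt{\kappa/8}$ as $t\to\infty$.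
   Context: Coordinates: normalized stereographic coordinates $x\in\mathbb R^4$ are those induced by stereographic projection of the unit sphere; in them $g_{S^4_a}=\frac{4a^2}{(1+|x|^2)^2}\,dx_i\otimes dx_i$. Quaternions: $\mathbb R^4$ is identified with the quaternions $\mathbb H$ via $x=\sum_{i=1}^4x_i\sigma_i$, where $\sigma_1=1$ and $\sigma_2,\sigma_3,\sigma_4$ are the imaginary units with $\sigma_2\sigma_3=\sigma_4$, $\sigma_3\sigma_4=\sigma_2$, $\sigma_4\sigma_2=\sigma_3$; $\bar x$ is the conjugate, $\mathrm{Im}(x)=\frac12(x-\bar x)$, and $dx=\sum_idx_i\sigma_i$ is the quaternion-valued differential. $\mathrm{Im}\,\mathbb H$ is identified with $\mathfrak{su}(2)$ and carries the inner product $\langle A,B\rangle=\frac12\mathrm{tr}(AB^* )$ (trace of complex $2\times2$ matrices), for which $\{\sigma_2,\sigma_3,\sigma_4\}$ is orthonormal. $A^1$ has curvature $F(x)=\frac{1}{(1+|x|^2)^2}\,d\bar x\wedge dx$, is anti-self-dual, and extends from the complement of the projection point to a smooth connection on $E\to S^4$. $\mathrm{Ric}$ is the Ricci curvature of the metric, $Z_{ij}=g^{pq}\langle F_{ip},F_{jq}\rangle$, and $(D^*F)_j=-\nabla^iF_{ij}$. The coupling parameter $\kappa(t)$ is positive and smooth. A tuple $(g,A,X,\omega)$ consisting of a Riemannian metric on $M$, a connection on $E\to M$, a vector field on $M$ and a section of $\mathfrak g_E$ is a coupled soliton if for some $\rho\in\mathbb R$ $$2\mathrm{Ric}-Z=\rho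 g-\mathcal L_Xg,\qquad D^*F=\nabla\omega-\mathcal L_XA;$$ it is shrinking, steady or expanding if $\rho>0$, $\rho=0$, $\rho<0$ respectively. $\mathcal L_XA\in\Omega^1(\mathfrak g_E)$ is the Lie derivative of the connection, which equals $F(X,\cdot)$ up to a term $\nabla\xi$ (depending on the lift of $X$ to $E$) that can be absorbed in $\omega$. ''The pair $(g,A)$ is a coupled soliton'' means that there are $X$ and $\omega$ with this property. *)

(* Defs.v *)
From HB Require Import structures.
From mathcomp Require Import all_boot all_order all_algebra.
From mathcomp Require Import all_classical all_reals all_analysis.
From mathcomp Require Import complex ring.

Set Implicit Arguments.
Unset Strict Implicit.
Unset Printing Implicit Defensive.

Import Order.TTheory GRing.Theory Num.Theory.
Import numFieldNormedType.Exports.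

Local Open Scope classical_set_scope.
Local Open Scope ring_scope.

(* The library has no smooth manifolds.  The sphere S^4 is handled through its
   atlas of two stereographic charts, both with image R^4 = 'rV[R]_4: a tensor
   field, connection or section on S^4 is a pair of coordinate representations
   (one per chart) that agree on the overlap.  The coordinate indices 1..4 of
   the mathematics are 0..3 in 'I_4. *)

Section Calculus.
Variable R : realType.
Implicit Types (x : 'rV[R]_4) (i j : 'I_4).

Definition evec i : 'rV[R]_4 := delta_mx 0 i.

Definition partial (V : normedModType R) i (f : 'rV[R]_4 -> V)
    (x : 'rV[R]_4) : V := 'D_(evec i) f x.

(* C^oo on an open set U: all iterated partial derivatives are differentiable
   at every point of U. *)
Definition smooth_on (V : normedModType R) (U : set 'rV[R]_4)
    (f : 'rV[R]_4 -> V) : Prop :=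
  forall (s : seq 'I_4) x, U x -> differentiable (foldr (@partial V) f s) x.

(* Euclidean |x|^2; the library norm `|x| of a row vector is the sup norm. *)
Definition sqnorm n (x : 'rV[R]_n) : R := \sum_(k < n) x 0 k ^+ 2.

Definition punctured : set 'rV[R]_4 := [set x | x != 0].

(* f'(t) = l, with s tending to t inside J (one-sided at endpoints of J). *)
Definition is_derive_within (V : normedModType R) (J : set R) (f : R -> V)
    (t : R) (l : V) : Prop :=
  (s - t)^-1 *: (f s - f t) @[s --> within J (dnbhs t)] --> l.

Definition smooth_within (J : set R) (f : R -> R) : Prop :=
  exists d : nat -> R -> R,
    (forall t, J t -> d 0%N t = f t) /\
    (forall n t, J t -> is_derive_within J (d n) t (d n.+1 t)).

End Calculus.

Arguments punctured : clear implicits.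

Section Quaternions.
Variable R : realType.
Implicit Types p q : 'rV[R]_4.

Definition quat (a b c d : R) : 'rV[R]_4 := \row_(k < 4) [:: a; b; c; d]`_k.

Definition qmul p q : 'rV[R]_4 := quat
  (p 0 0 * q 0 0 - p 0 1 * q 0 1 - p 0 2 * q 0 2 - p 0 3 * q 0 3)
  (p 0 0 * q 0 1 + p 0 1 * q 0 0 + p 0 2 * q 0 3 - p 0 3 * q 0 2)
  (p 0 0 * q 0 2 - p 0 1 * q 0 3 + p 0 2 * q 0 0 + p 0 3 * q 0 1)
  (p 0 0 * q 0 3 + p 0 1 * q 0 2 - p 0 2 * q 0 1 + p 0 3 * q 0 0).

Definition qconj q : 'rV[R]_4 := quat (q 0 0) (- q 0 1) (- q 0 2) (- q 0 3).

Definition qone : 'rV[R]_4 := quat 1 0 0 0.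

Definition qIm q : 'rV[R]_4 := 2^-1 *: (q - qconj q).

Definition imaginary q : Prop := q 0 0 = 0.

Definition qbr p q : 'rV[R]_4 := qmul p q - qmul q p.

(* The standard identification of quaternions with complex 2 x 2 matrices,
   sending unit quaternions onto SU(2) and Im H onto su(2). *)
Definition qmx q : 'M[R[i]]_2 := \matrix_(j, k)
  if j == 0 then (if k == 0 then Complex (q 0 0) (q 0 1)
                  else Complex (q 0 2) (q 0 3))
  else (if k == 0 then Complex (- q 0 2) (q 0 3)
        else Complex (q 0 0) (- q 0 1)).

(* <A, B> = 1/2 tr(A B^* ), a real number for A, B in su(2). *)
Definition inner p q : R :=
  2^-1 * complex.Re (\tr (qmx p *m (map_mx (@conjc R) (qmx q))^T)).

(* tr(A B), also real on su(2). *)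
Definition qtr2 p q : R := complex.Re (\tr (qmx p *m qmx q)).

End Quaternions.

Section LocalGeometry.
Variable R : realType.

(* Local representatives over an open subset of R^4: a bilinear form, a
   vector field, an Im H-valued one-form (component, then point) and an
   Im H-valued function. *)
Definition lmetric := 'rV[R]_4 -> 'M[R]_4.
Definition lvector := 'rV[R]_4 -> 'rV[R]_4.
Definition lform := 'I_4 -> 'rV[R]_4 -> 'rV[R]_4.
Definition lsection := 'rV[R]_4 -> 'rV[R]_4.

Implicit Types (g : lmetric) (X : lvector) (A : lform) (w : lsection).
Implicit Types (x : 'rV[R]_4) (i j k l : 'I_4).

Definition dg g i j k x : R := (partial i g x) j k.

(* christoffel g k i j is Gamma^k_{ij}. *)
Definition christoffel g k i j x : R :=
  2^-1 * \sum_l invmx (g x) k l * (dg g i j l x + dg g j i l x - dg g l i j x).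

Definition ricci g x : 'M[R]_4 := \matrix_(j, k)
  (\sum_i (partial i (christoffel g i j k : 'rV[R]_4 -> R^o) x
           - partial j (christoffel g i i k : 'rV[R]_4 -> R^o) x)
   + \sum_i \sum_l (christoffel g i i l x * christoffel g l j k x
                    - christoffel g i j l x * christoffel g l i k x)).

(* L_X g *)
Definition lie_metric X g x : 'M[R]_4 := \matrix_(i, j)
  \sum_k (X x 0 k * dg g k i j x + g x k j * (partial i X x) 0 k
          + g x i k * (partial j X x) 0 k).

(* F = dA + A /\ A *)
Definition curvature A i j x : 'rV[R]_4 :=
  partial i (A j) x - partial j (A i) x + qbr (A i x) (A j x).

Definition Zform g A x : 'M[R]_4 := \matrix_(i, j)
  \sum_p \sum_q invmx (g x) p q * inner (curvature A i p x) (curvature A j q x).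

(* covF g A k i j is nabla_k F_{ij}, with nabla the coupling of the Levi-Civita
   connection of g with A. *)
Definition covF g A k i j x : 'rV[R]_4 :=
  partial k (curvature A i j) x + qbr (A k x) (curvature A i j x)
  - \sum_l (christoffel g l k i x *: curvature A l j x
            + christoffel g l k j x *: curvature A i l x).

(* (D^* F)_j = - nabla^i F_{ij} *)
Definition Dstar g A j x : 'rV[R]_4 :=
  - \sum_i \sum_k invmx (g x) i k *: covF g A k i j x.

Definition cov_section A w j x : 'rV[R]_4 :=
  partial j w x + qbr (A j x) (w x).

(* L_X A computed with the A-horizontal lift of X to E, that is F(X, .);
   any other lift adds a term nabla xi. *)
Definition lie_connection X A j x : 'rV[R]_4 :=
  \sum_i X x 0 i *: curvature A i j x.

End LocalGeometry.

Section Sphere.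
Variable R : realType.
Implicit Types (x : 'rV[R]_4) (i j : 'I_4).

(* [North] is stereographic projection from the north pole, [South] from the
   south pole. *)
Inductive chart := North | South.

(* Inverse stereographic projection onto the unit sphere of R^5 = R^4 x R. *)
Definition stereo (c : chart) x : 'rV[R]_(4 + 1) :=
  (1 + sqnorm x)^-1 *:
    row_mx (2 *: x)
      (const_mx (if c is North then sqnorm x - 1 else 1 - sqnorm x)).

(* The change of charts x |-> x / |x|^2, an involution of R^4 \ {0}. *)
Definition inversion x : 'rV[R]_4 := (sqnorm x)^-1 *: x.

Lemma sqnorm_eq0 x : (sqnorm x == 0) = (x == 0).
Proof.
apply/idP/eqP => [|->]; last first.
  by rewrite /sqnorm big1 // => k _; rewrite mxE expr0n.
rewrite psumr_eq0 => [/allP h|k _]; last exact: sqr_ge0.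
apply/rowP => k; have := h k (mem_index_enum k).
by rewrite !mxE sqrf_eq0 => /eqP.
Qed.

Lemma sqnorm_ge0 x : 0 <= sqnorm x.
Proof. by apply: sumr_ge0 => k _; exact: sqr_ge0. Qed.

Lemma stereo_inversion x : x != 0 ->
  stereo South (inversion x) = stereo North x.
Proof.
move=> x0; have s0 : sqnorm x != 0 by rewrite sqnorm_eq0.
have s1 : 1 + sqnorm x != 0 by rewrite gt_eqF// ltr_pwDl// sqnorm_ge0.
have sE : sqnorm (inversion x) = (sqnorm x)^-1.
  rewrite /sqnorm /inversion; under eq_bigr do rewrite mxE exprMn.
  by rewrite -mulr_sumr -/(sqnorm x) expr2 -mulrA mulVf// mulr1.
have e : 1 + (sqnorm x)^-1 = (1 + sqnorm x) / sqnorm x.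
  by rewrite mulrDl mul1r mulfV// addrC.
rewrite /stereo sE !scale_row_mx e invf_div; congr row_mx.
  rewrite /inversion !scalerA; congr (_ *: _).
  by field; rewrite s0 s1.
by apply/matrixP => i j; rewrite !mxE; field; rewrite s0 s1.
Qed.

(* Row i is the i-th partial derivative of the change of charts. *)
Definition Jinv x : 'M[R]_4 :=
  \matrix_(i, j) (partial i inversion x) 0 j.

Definition metric := chart -> lmetric R.
Definition vector_field := chart -> lvector R.
Definition connection := chart -> lform R.
Definition gE_section := chart -> lsection R.

(* g_{S^4_a}: the metric induced from R^5 on the sphere of radius a. *)
Definition round_metric (a : R) : metric := fun c x =>
  \matrix_(i, j) ((a *: partial i (stereo c) x) *m
                  (a *: partial j (stereo c) x)^T) 0 0.

Definition rescale (s : R) (g : metric) : metric := fun c x => s *: g c x.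

Definition is_metric (g : metric) : Prop :=
  [/\ forall c, smooth_on setT (g c),
      forall c x, (g c x)^T = g c x,
      forall c x (v : 'rV[R]_4), v != 0 -> 0 < (v *m g c x *m v^T) 0 0
    & forall x, x != 0 ->
        g North x = Jinv x *m g South (inversion x) *m (Jinv x)^T].

Definition is_vector_field (X : vector_field) : Prop :=
  (forall c, smooth_on setT (X c)) /\
  (forall x, x != 0 -> X South (inversion x) = X North x *m Jinv x).

(* An SU(2) bundle over S^4 is trivial over both (contractible) charts, so up
   to isomorphism it is given by its transition function on the overlap, here
   a function h of the North coordinate x != 0 with values in the unit
   quaternions: a section s of E satisfies s_South = h s_North. *)
Definition is_SU2_bundle (h : 'rV[R]_4 -> 'rV[R]_4) : Prop :=
  smooth_on (punctured R) h /\
  (forall x, x != 0 -> qmul (h x) (qconj (h x)) = qone R).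

(* The local one-forms of a connection nabla = d + A satisfy
   A_South = h A_North h^-1 - dh h^-1. *)
Definition is_connection (h : 'rV[R]_4 -> 'rV[R]_4) (A : connection) : Prop :=
  [/\ forall c i, smooth_on setT (A c i),
      forall c i x, imaginary (A c i x)
    & forall i x, x != 0 ->
        \sum_j Jinv x i j *: A South j (inversion x) =
        qmul (qmul (h x) (A North i x)) (qconj (h x))
        - qmul (partial i h x) (qconj (h x))].

Definition is_gE_section (h : 'rV[R]_4 -> 'rV[R]_4) (w : gE_section) : Prop :=
  [/\ forall c, smooth_on setT (w c),
      forall c x, imaginary (w c x)
    & forall x, x != 0 ->
        w South (inversion x) = qmul (qmul (h x) (w North x)) (qconj (h x))].

Definition integralR4 (f : 'rV[R]_4 -> R) : R :=
  Rintegral lebesgue_measure setT (fun t1 : R =>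
  Rintegral lebesgue_measure setT (fun t2 : R =>
  Rintegral lebesgue_measure setT (fun t3 : R =>
  Rintegral lebesgue_measure setT (fun t4 : R => f (quat t1 t2 t3 t4))))).

(* tr(F /\ F) = trFF dx1 /\ dx2 /\ dx3 /\ dx4. *)
Definition trFF (A : lform R) x : R :=
  let F := fun i j => curvature A i j x in
  2 * (qtr2 (F 0 1) (F 2 3) - qtr2 (F 0 2) (F 1 3) + qtr2 (F 0 3) (F 1 2)).

(* Chern-Weil: c_2(E) = 1/(8 pi^2) int_{S^4} tr(F /\ F) for any connection on
   E, where S^4 is oriented by the North coordinates; the North chart misses
   a single point. *)
Definition c2_is (h : 'rV[R]_4 -> 'rV[R]_4) (n : int) : Prop :=
  exists2 A : connection, is_connection h A &
    (8 * pi ^+ 2)^-1 * integralR4 (trFF (A North)) = n%:~R.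

Definition instanton (i : 'I_4) x : 'rV[R]_4 :=
  qIm ((1 + sqnorm x)^-1 *: qmul (qconj x) (evec R i)).

Definition coupled_soliton (h : 'rV[R]_4 -> 'rV[R]_4) (g : metric)
    (A : connection) (X : vector_field) (w : gE_section) (rho : R) : Prop :=
  [/\ [/\ is_metric g, is_connection h A, is_vector_field X
        & is_gE_section h w],
      forall c x, 2 *: ricci (g c) x - Zform (g c) (A c) x =
                  rho *: g c x - lie_metric (X c) (g c) x
    & forall c j x, Dstar (g c) (A c) j x =
                    cov_section (A c) (w c) j x
                    - lie_connection (X c) (A c) j x].

Definition shrinking_soliton h g A : Prop :=
  exists X w rho, coupled_soliton h g A X w rho /\ 0 < rho.

Definition steady_soliton h g A : Prop :=
  exists X w rho, coupled_soliton h g A X w rho /\ rho = 0.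

Definition expanding_soliton h g A : Prop :=
  exists X w rho, coupled_soliton h g A X w rho /\ rho < 0.

Definition coupled_flow (h : 'rV[R]_4 -> 'rV[R]_4) (J : set R) (kappa : R -> R)
    (g : R -> metric) (A : R -> connection) : Prop :=
  forall t, J t ->
  [/\ is_metric (g t), is_connection h (A t),
      forall c x, is_derive_within J (fun s => g s c x) t
        (- 2 *: ricci (g t c) x + kappa t *: Zform (g t c) (A t c) x)
    & forall c j x, is_derive_within J (fun s => A s c j x) t
        (- Dstar (g t c) (A t c) j x)].

End Sphere.

(* Main.v *)
Require Import Defs.
From mathcomp Require Import all_boot all_order all_algebra.
From mathcomp Require Import all_classical all_reals all_analysis.
From mathcomp Require Import complex ring lra.
Import Order.TTheory GRing.Theory Num.Theory.
Import numFieldNormedType.Exports.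
Local Open Scope classical_set_scope.
Local Open Scope ring_scope.

Set Implicit Arguments.
Unset Strict Implicit.
Unset Printing Implicit Defensive.

(** In both stereographic charts the round metric of radius a is 4 a^2 f^2 times
    the Euclidean one, where f = 1 / (1 + |x|^2). The theorem rests on three
    facts, valid in both charts:

      Ric = (3 / a^2) g,   Z = (3 / (4 a^4)) g,   D^*F = 0

    ([ricci_einstein], [Zform_instanton], [Dstar_instanton]). They give the
    soliton equations with X = 0, omega = 0 and
    rho = 6 / a^2 - 3 / (4 a^4) = 3 (8 a^2 - 1) / (4 a^4), whose sign is that of
    a^2 - 1/8; and since Ric does not change under rescaling while Z = 3 / (4 a^2)
    times the unit round metric, the flow reduces to the equation for a^2.

    The North chart is a computation. Quaternion identities give
    F_ij = f^2 (conj(e_i) e_j - conj(e_j) e_i), hence Z. For D^*F, dimension four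
    enters: the Christoffel terms of a conformally flat metric cancel in the
    contraction, so D^*F is a multiple of the flat divergence
    sum_i (d_i F_ij + [A_i, F_ij]) ([Dstar_round]), which vanishes by a second
    identity.

    In the South chart the connection is known only away from the origin, through
    the inversion y -> y / |y|^2 and an arbitrary transition function h. The
    quaternion-valued function k(y) = h(y / |y|^2) conj(y) satisfies
    d k = k B - A k, where A is the South form of the connection and
    B = Im(y d conj(y)) / (1 + |y|^2) + d log|y| is explicit
    ([partial_south_gauge]). The real closed summand d log|y| compensates for
    |k| = |y| without changing the curvature, and spares the square root of
    normalizing k. Differentiating d k once more, the symmetry of second
    derivatives ([derive_comm]) gives k F_B = F_A k, and differentiating this in
    turn transports the flat divergence ([gauge_flat_div]). So D^*F = 0 and the
    formula for Z hold off the origin, hence at the origin by continuity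
    ([eq_at0_of_punctured]), because the connection is smooth there.

    With y = a^2 and c = kappa / 8 the radius equation is y' = - 6 (y - c) / y.
    Along it (y - c)^2 does not increase, so y stays below some M, and then
    exp(12 t / M) (y - c)^2 does not increase either ([weighted_nincr]); this is
    the exponential convergence. For existence, y = c + u0 exp(- w) turns the
    equation into (c + u0 exp(- w)) w' = 6, which integrates to
    c w + u0 (1 - exp(- w)) = 6 (t - t0); the left side is strictly increasing and
    unbounded on w >= 0, so w(t) is found by inverting it
    ([radius_existence]). *)

(** * Partial derivatives on R^4 *)

Section MatrixCalculus.
Context {R : realType} {V : normedModType R}.

Lemma differentiable_mxP {m n} (M : V -> 'M[R]_(m, n)) x :
  differentiable M x <->
  forall i j, differentiable (fun y => M y i j : R^o) x.
Proof.
split=> [dM i j|dM].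
  exact: (differentiable_comp dM (differentiable_coord (M x) i j)).
have -> : M = \sum_(i < m) \sum_(j < n) (fun y => M y i j *: delta_mx i j).
  apply/funext => y; rewrite [LHS]matrix_sum_delta fct_sumE.
  by apply: eq_bigr => i _; rewrite fct_sumE.
do 2 apply: differentiable_sum => ?.
exact: differentiableZl.
Qed.

End MatrixCalculus.

Section PartialDerivatives.
Context {R : realType}.
Implicit Types (x : 'rV[R]_4) (i j : 'I_4).

Lemma partial_mxE {m n} (M : 'rV[R]_4 -> 'M[R]_(m, n)) i x a b :
  differentiable M x ->
  (partial i M x) a b = partial i (fun y => M y a b : R^o) x.
Proof. by move=> dM; rewrite /partial derive_mx ?mxE//; exact: diff_derivable. Qed.

Lemma partialD (V : normedModType R) (f g : 'rV[R]_4 -> V) i x :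
  differentiable f x -> differentiable g x ->
  partial i (fun y => f y + g y) x = partial i f x + partial i g x.
Proof. by move=> df dg; apply: deriveD; exact: diff_derivable. Qed.

Lemma partialB (V : normedModType R) (f g : 'rV[R]_4 -> V) i x :
  differentiable f x -> differentiable g x ->
  partial i (fun y => f y - g y) x = partial i f x - partial i g x.
Proof. by move=> df dg; apply: deriveB; exact: diff_derivable. Qed.

Lemma partial_sum (V : normedModType R) n (f : 'I_n -> 'rV[R]_4 -> V) i x :
  (forall k, differentiable (f k) x) ->
  partial i (fun y => \sum_k f k y) x = \sum_k partial i (f k) x.
Proof.
move=> df; rewrite /partial (_ : (fun y => _) = \sum_k f k); last first.
  by apply/funext => y; rewrite fct_sumE.
by rewrite derive_sum// => k; exact: diff_derivable.
Qed.

Lemma partialM (f g : 'rV[R]_4 -> R^o) i x :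
  differentiable f x -> differentiable g x ->
  partial i (fun y => f y * g y : R^o) x = partial i f x * g x + f x * partial i g x.
Proof.
move=> df dg; rewrite /partial (deriveM (diff_derivable df) (diff_derivable dg)).
by rewrite addrC [g x *: _]mulrC.
Qed.

Lemma partial_cst (V : normedModType R) (a : V) i x : partial i (fun=> a) x = 0.
Proof. exact: derive_cst. Qed.

Lemma partialZ {m n} (f : 'rV[R]_4 -> R^o) (M : 'rV[R]_4 -> 'M[R]_(m, n)) i x :
  differentiable f x -> differentiable M x ->
  partial i (fun y => f y *: M y) x = partial i f x *: M x + f x *: partial i M x.
Proof.
move=> df dM; have /differentiable_mxP dMc := dM.
apply/matrixP => a b; rewrite partial_mxE; last first.
  apply/differentiable_mxP => a' b'.
  under eq_fun do rewrite mxE.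
  exact: (differentiableM df (dMc _ _)).
under eq_fun do rewrite mxE.
rewrite (partialM _ df (dMc _ _)) !mxE.
by rewrite (partial_mxE _ _ _ dM).
Qed.

Lemma differentiable_scale {m n} (f : 'rV[R]_4 -> R^o) (M : 'rV[R]_4 -> 'M[R]_(m, n)) x :
  differentiable f x -> differentiable M x ->
  differentiable (fun y => f y *: M y) x.
Proof.
move=> df /differentiable_mxP dM; apply/differentiable_mxP => a b.
under eq_fun do rewrite mxE.
exact: (differentiableM df (dM _ _)).
Qed.

Lemma partial_coord i k x : partial i (fun y => y 0 k : R^o) x = (i == k)%:R.
Proof.
have /partial_mxE <- : differentiable (id : 'rV[R]_4 -> 'rV[R]_4) x by [].
by rewrite /partial derive_id mxE eqxx eq_sym.
Qed.

Lemma differentiable_sqr_coord k x :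
  differentiable (fun y : 'rV[R]_4 => y 0 k ^+ 2 : R^o) x.
Proof.
under eq_fun do rewrite expr2.
exact: (differentiableM (differentiable_coord x 0 k) (differentiable_coord x 0 k)).
Qed.

Lemma differentiable_sqnorm x :
  differentiable (fun y : 'rV[R]_4 => sqnorm y : R^o) x.
Proof.
rewrite (_ : (fun y => _) = \sum_k (fun y : 'rV[R]_4 => y 0 k ^+ 2 : R^o)).
  by apply: differentiable_sum => k; exact: differentiable_sqr_coord.
by apply/funext => y; rewrite fct_sumE.
Qed.

Lemma partial_sqnorm i x : partial i (fun y => sqnorm y : R^o) x = 2 * x 0 i.
Proof.
rewrite partial_sum => [|k]; last exact: differentiable_sqr_coord.
under eq_bigr => k _.
  under eq_fun do rewrite expr2.
  rewrite (partialM _ (differentiable_coord x 0 k) (differentiable_coord x 0 k)).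
  rewrite partial_coord.
  over.
rewrite (bigD1 i)//= big1 => [|k /negbTE ki].
  by rewrite eqxx mul1r mulr1 addr0 mulr2n mulrDl mul1r.
by rewrite eq_sym ki mul0r mulr0 addr0.
Qed.

Lemma partialV (f : 'rV[R]_4 -> R^o) i x :
  differentiable f x -> f x != 0 ->
  partial i (fun y => (f y)^-1 : R^o) x = - (f x) ^- 2 * partial i f x.
Proof. by move=> df f0; rewrite /partial deriveV//; exact: diff_derivable. Qed.

End PartialDerivatives.

Section LocalPartials.
Context {R : realType}.
Implicit Types (U : set 'rV[R]_4) (x : 'rV[R]_4) (i j : 'I_4).

Lemma partial_diff (V : normedModType R) (f : 'rV[R]_4 -> V) i x :
  differentiable f x -> partial i f x = 'd f x (evec R i).
Proof. by move=> df; rewrite /partial deriveE. Qed.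

Lemma open_near U (P : 'rV[R]_4 -> Prop) x :
  open U -> U x -> (forall y, U y -> P y) -> \forall y \near x, P y.
Proof. by move=> oU Ux UP; apply: filterS (open_nbhs_nbhs (conj oU Ux)). Qed.

Lemma eq_partial_on (V : normedModType R) U (f g : 'rV[R]_4 -> V) i x :
  open U -> U x -> (forall y, U y -> f y = g y) -> partial i f x = partial i g x.
Proof. by move=> oU Ux fg; apply: near_eq_derive; exact: open_near oU Ux fg. Qed.

Lemma differentiable_on (V : normedModType R) U (f g : 'rV[R]_4 -> V) x :
  open U -> U x -> (forall y, U y -> f y = g y) -> differentiable g x -> differentiable f x.
Proof.
move=> oU Ux fg dg.
have fE : f \o shift x = cst (f x) + 'd g x +o_ (0 : 'rV[R]_4) id.
  apply/eqaddoP => e e0; have /eqaddoP/(_ e e0) := diff_locally dg.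
  have U0 : \forall h \near (0 : 'rV[R]_4), U (h + x).
    have := open_nbhs_nbhs (conj oU Ux); rewrite -[nbhs x U]/(\near x, U x) (near_shift 0) subr0.
    exact.
  apply: filterS2 U0 => h Uh; rewrite /= !fctE /=.
  by rewrite !fg.
have dfE := diff_unique (diff_continuous dg) fE.
by apply/diff_locallyP; rewrite dfE; split => //; exact: diff_continuous.
Qed.

End LocalPartials.

(** * Symmetry of second partial derivatives *)

Section MixedPartials.
Context {R : realType} {V : normedModType R}.
Implicit Types (f : V -> R^o) (x u v p : V).

Lemma is_derive_line f u p (s : R) : differentiable f (s *: u + p) ->
  is_derive s 1 (fun r : R => f (r *: u + p)) ('D_u f (s *: u + p)).
Proof.
move=> /(@diff_derivable _ _ _ _ _ u) df.
have E : (fun h : R => h^-1 *: (((fun r : R => f (r *: u + p)) \o shift s) (h *: 1)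
            - f (s *: u + p))) =
         (fun h : R => h^-1 *: ((f \o shift (s *: u + p)) (h *: u) - f (s *: u + p))).
  by apply/funext => h /=; rewrite addrA -scalerDl [_ *: 1]mulr1.
by split; [rewrite /derivable E | rewrite /derive E].
Qed.

(** The expression approximated here is symmetric in u and v, while its limit after
division by t^2 is the iterated derivative in a definite order: this forces the
two orders to agree. The mean value theorem in the direction u reduces the second
difference to an increment of the derivative 'D_u f along v, which is then
linearized at x. *)
Lemma second_difference f x u v (e : R) : 0 < e ->
  (\forall y \near x, differentiable f y) -> differentiable ('D_u f) x ->
  \forall t \near 0^'+, 
   `|f (t *: u + (t *: v + x)) - f (t *: u + x) - f (t *: v + x) + f x
     - t ^+ 2 * 'D_v ('D_u f) x| <= e * t ^+ 2.
Proof.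
move=> e0 df dg; set g := 'D_u f.
pose K := `|u| + `|v| + 1; have K0 : 0 < K by rewrite ltr_wpDl// addr_ge0.
have e'0 : 0 < e / (2 * K) by rewrite divr_gt0// mulr_gt0.
(* K bounds |s u + r v| / t for 0 <= s, r <= t; the linearization error is
   committed at two points, hence the factor 2. *)
set e' := e / (2 * K) in e'0 *.
have q1 : \forall h \near (0 : V), `|g (h + x) - g x - 'd g x h| <= e' * `|h|.
  move/eqaddoP: (diff_locally dg) => /(_ _ e'0).
  apply: filterS => h; congr (`|_| <= _).
  by rewrite /= opprD addrA.
have df0 : \forall h \near (0 : V), differentiable f (h + x).
  by move: df; rewrite (near_shift 0); apply: filterS => h; rewrite /= subr0.
have [d /= d0 dB] := (nbhs_ballP _ _).1 (filterI q1 df0).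
have inB (a b : R) : 0 <= a <= d / (2 * K) -> 0 <= b <= d / (2 * K) ->
    ball (0 : V) d (a *: u + b *: v).
  move=> /andP[a0 ad] /andP[b0 bd]; rewrite -ball_normE /= sub0r normrN.
  apply: (le_lt_trans (ler_normD _ _)); rewrite !normrZ !ger0_norm//.
  apply: (@le_lt_trans _ _ (d / (2 * K) * (`|u| + `|v|))).
    by rewrite mulrDr lerD// ler_wpM2r.
  rewrite mulrAC ltr_pdivrMr ?mulr_gt0// ltr_pM2l// /K.
  by have := normr_ge0 u; have := normr_ge0 v; lra.
near=> t.
have t0 : 0 < t by [].
have td : t <= d / (2 * K).
  by near: t; apply: nbhs_right_le; rewrite divr_gt0// mulr_gt0.
(* The second difference is phi t - phi 0. *)
pose phi s := f (s *: u + (t *: v + x)) - f (s *: u + x).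
pose dphi s := g (s *: u + (t *: v + x)) - g (s *: u + x).
have dphiE s : 0 <= s <= t -> is_derive s 1 (phi : R -> R) (dphi s).
  move=> /andP[s0 st]; have sd := le_trans st td.
  apply: is_deriveB; apply: is_derive_line.
    by rewrite addrA; apply: (dB (_ + _) _).2; apply: inB; apply/andP; split=> //; exact: ltW.
  rewrite -[s *: u]addr0 -(scale0r v); apply: (dB (_ + _) _).2.
  apply: inB; rewrite ?s0 ?sd// lexx/=; exact: le_trans s0 sd.
have [c cI phiE] :
    exists2 c, c \in `[0, t]%R & phi t - phi 0 = dphi c * (t - 0).
  apply: MVT_segment => [|s|]; first exact: ltW.
    by rewrite in_itv/= => /andP[s0 st]; apply: dphiE; rewrite !ltW.
  apply: derivable_within_continuous => s; rewrite in_itv/= => /dphiE.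
  by case.
have /andP[c0 ct] : 0 <= c <= t by move: cI; rewrite in_itv.
have -> : f (t *: u + (t *: v + x)) - f (t *: u + x) - f (t *: v + x) + f x =
    dphi c * t.
  rewrite -[t in RHS]subr0 -phiE /phi !scale0r !add0r; ring.
have cd := le_trans ct td.
have [q2 _] := dB _ (inB c t (introT andP (conj c0 cd)) (introT andP (conj (ltW t0) td))).
have [q3 _] := dB _ (inB c 0 (introT andP (conj c0 cd))
    (introT andP (conj (lexx 0) (le_trans c0 cd)))).
have nb (b : R) : 0 <= b <= t -> `|c *: u + b *: v| <= t * K.
  move=> /andP[b0 bt]; apply: (le_trans (ler_normD _ _)); rewrite !normrZ !ger0_norm//.
  rewrite /K !mulrDr; have := ler_wpM2r (normr_ge0 u) ct.
  by have := ler_wpM2r (normr_ge0 v) bt; lra.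
have dL (b : R) : 'd g x (c *: u + b *: v) = c * 'd g x u + b * 'D_v g x.
  by rewrite linearD !linearZ (deriveE v dg).
rewrite dL in q2; rewrite dL scale0r addr0 mul0r addr0 in q3.
rewrite -addrA in q2.
have {}q2 := le_trans q2 (ler_wpM2l (ltW e'0) (nb _ (introT andP (conj (ltW t0) (lexx t))))).
have := nb 0; rewrite scale0r addr0 lexx ltW// => /(_ isT) nb0.
have {}q3 := le_trans q3 (ler_wpM2l (ltW e'0) nb0).
have factor (A D : R) : A * t - t ^+ 2 * D = t * (A - t * D) by ring.
rewrite factor.
rewrite normrM gtr0_norm// /dphi.
rewrite [leRHS]mulrCA ler_pM2l//.
have eE : e * t = e' * (t * K) + e' * (t * K).
  by rewrite /e'; field; rewrite gt_eqF.
rewrite eE; apply: (le_trans _ (lerD q2 q3)).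
apply: le_trans (ler_normB _ _); rewrite le_eqVlt; apply/orP; left; apply/eqP.
have regroup (A B C D E : R) : A - B - E = A - C - (D + E) - (B - C - D) by ring.
by rewrite (regroup _ _ (g x) (c * 'd g x u) _) !addrA.
Unshelve. all: by end_near. Qed.

(** Young's form of the symmetry of second derivatives: differentiability of the
two first derivatives at the single point x suffices. This weak hypothesis is what
makes it usable for gauge functions, whose first derivatives are known to be
differentiable from the gauge equation itself. *)
Lemma derive_comm f x u v :
  (\forall y \near x, differentiable f y) ->
  differentiable ('D_u f) x -> differentiable ('D_v f) x ->
  'D_v ('D_u f) x = 'D_u ('D_v f) x.
Proof.
move=> df du dv; apply/eqP; rewrite -subr_eq0 -normr_le0; apply/ler_addgt0Pl => e e0.
rewrite addr0.
have e2 : 0 < e / 2 by rewrite divr_gt0.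
have uv := second_difference v e2 df du.
have vu := second_difference u e2 df dv.
have [t [[/= {}uv {}vu] t0]] := filter_ex (filterI (filterI uv vu) (nbhs_right_gt 0)).
have t20 : 0 < t ^+ 2 by rewrite exprn_gt0.
rewrite -(ler_pM2l t20) -{1}(gtr0_norm t20) -normrM.
have -> : t ^+ 2 * e = e / 2 * t ^+ 2 + e / 2 * t ^+ 2 by field.
apply: (le_trans _ (lerD vu uv)).
apply: le_trans (ler_normB _ _); rewrite le_eqVlt; apply/orP; left; apply/eqP.
have regroup (A B C D E F G : R) :
  E * F - E * G = A - B - C + D - E * G - (A - C - B + D - E * F) by ring.
rewrite mulrBr [t *: v + (_ + _)]addrCA.
by rewrite (regroup (f (t *: u + (t *: v + x))) (f (t *: v + x)) (f (t *: u + x)) (f x)).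
Qed.

End MixedPartials.

Section MixedPartialsOfRows.
Context {R : realType}.
Implicit Types (U : set 'rV[R]_4) (x : 'rV[R]_4) (i j : 'I_4).

Lemma partialC_scalar U (f : 'rV[R]_4 -> R^o) i j x : open U -> U x ->
  (forall y, U y -> differentiable f y) ->
  differentiable (partial i f) x -> differentiable (partial j f) x ->
  partial i (partial j f) x = partial j (partial i f) x.
Proof.
move=> oU Ux df di dj; apply: derive_comm dj di; exact: open_near oU Ux df.
Qed.

Opaque partial.

Lemma partial_rowE n (k : 'rV[R]_4 -> 'rV[R]_n) i x q : differentiable k x ->
  (partial i k x : 'rV[R]_n) 0 q = partial i (fun y => k y 0 q : R^o) x.
Proof. exact: partial_mxE. Qed.

Lemma partialC n U (k : 'rV[R]_4 -> 'rV[R]_n) i j x : open U -> U x ->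
  (forall y, U y -> differentiable k y) ->
  differentiable (partial i k) x -> differentiable (partial j k) x ->
  partial i (partial j k) x = partial j (partial i k) x.
Proof.
move=> oU Ux dk di dj; apply/rowP => q.
pose f : 'rV[R]_4 -> R^o := fun y => k y 0 q.
have E l y : U y -> (partial l k y : 'rV[R]_n) 0 q = partial l f y.
  by move=> /dk dky; exact: partial_rowE.
apply: etrans (partial_rowE i q dj) _; apply/esym; apply: etrans (partial_rowE j q di) _.
rewrite (eq_partial_on i oU Ux (E j)) (eq_partial_on j oU Ux (E i)).
have df l : differentiable (partial l k) x -> differentiable (partial l f) x.
  move=> /differentiable_mxP/(_ 0 q); apply: differentiable_on oU Ux _.
  by move=> y Uy; rewrite -E.
apply: (partialC_scalar oU Ux) (df _ dj) (df _ di) => y Uy.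
by have /differentiable_mxP/(_ 0 q) := dk y Uy.
Qed.
End MixedPartialsOfRows.

(** * Quaternion algebra *)

Section QuaternionComponents.
Context {R : realType}.
Implicit Types (p q r u v : 'rV[R]_4).

Lemma ord4_ind (P : 'I_4 -> Prop) : P 0 -> P 1 -> P 2 -> P 3 -> forall i, P i.
Proof.
move=> P0 P1 P2 P3 [[|[|[|[|//]]]] i4].
- by rewrite (_ : Ordinal i4 = 0)//; apply: val_inj.
- by rewrite (_ : Ordinal i4 = 1)//; apply: val_inj.
- by rewrite (_ : Ordinal i4 = 2)//; apply: val_inj.
- by rewrite (_ : Ordinal i4 = 3)//; apply: val_inj.
Qed.

Lemma row4P p q : p 0 0 = q 0 0 -> p 0 1 = q 0 1 -> p 0 2 = q 0 2 ->
  p 0 3 = q 0 3 -> p = q.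
Proof. by move=> p0 p1 p2 p3; apply/rowP; elim/ord4_ind. Qed.

Lemma sum4E (V : nmodType) (F : 'I_4 -> V) : \sum_i F i = F 0 + F 1 + F 2 + F 3.
Proof.
rewrite !big_ord_recl big_ord0 addr0 !addrA.
by congr (_ + _ + _ + _); congr F; apply: val_inj.
Qed.

Lemma evecE (i k : 'I_4) : evec R i 0 k = (k == i)%:R.
Proof. by rewrite mxE eqxx. Qed.

Lemma row_addE n (a b : 'rV[R]_n) k : (a + b) 0 k = a 0 k + b 0 k.
Proof. by rewrite mxE. Qed.
Lemma row_oppE n (a : 'rV[R]_n) k : (- a) 0 k = - a 0 k.
Proof. by rewrite mxE. Qed.
Lemma row_scaleE n (c : R) (a : 'rV[R]_n) k : (c *: a) 0 k = c * a 0 k.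
Proof. by rewrite mxE. Qed.

Lemma row_0E n k : (0 : 'rV[R]_n) 0 k = 0.
Proof. by rewrite mxE. Qed.

Lemma qmul0E p q : qmul p q 0 0 =
  p 0 0 * q 0 0 - p 0 1 * q 0 1 - p 0 2 * q 0 2 - p 0 3 * q 0 3.
Proof. by rewrite mxE. Qed.
Lemma qmul1E p q : qmul p q 0 1 =
  p 0 0 * q 0 1 + p 0 1 * q 0 0 + p 0 2 * q 0 3 - p 0 3 * q 0 2.
Proof. by rewrite mxE. Qed.
Lemma qmul2E p q : qmul p q 0 2 =
  p 0 0 * q 0 2 - p 0 1 * q 0 3 + p 0 2 * q 0 0 + p 0 3 * q 0 1.
Proof. by rewrite mxE. Qed.
Lemma qmul3E p q : qmul p q 0 3 =
  p 0 0 * q 0 3 + p 0 1 * q 0 2 - p 0 2 * q 0 1 + p 0 3 * q 0 0.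
Proof. by rewrite mxE. Qed.

Lemma qconj0E p : qconj p 0 0 = p 0 0. Proof. by rewrite mxE. Qed.
Lemma qconj1E p : qconj p 0 1 = - p 0 1. Proof. by rewrite mxE. Qed.
Lemma qconj2E p : qconj p 0 2 = - p 0 2. Proof. by rewrite mxE. Qed.
Lemma qconj3E p : qconj p 0 3 = - p 0 3. Proof. by rewrite mxE. Qed.

Lemma qone0E : qone R 0 0 = 1. Proof. by rewrite mxE. Qed.
Lemma qone1E : qone R 0 1 = 0. Proof. by rewrite mxE. Qed.
Lemma qone2E : qone R 0 2 = 0. Proof. by rewrite mxE. Qed.
Lemma qone3E : qone R 0 3 = 0. Proof. by rewrite mxE. Qed.

Lemma qIm0E p : qIm p 0 0 = 0.
Proof. by rewrite !(row_scaleE, row_addE, row_oppE) qconj0E subrr mulr0. Qed.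
Lemma qIm1E p : qIm p 0 1 = p 0 1.
Proof. by rewrite !(row_scaleE, row_addE, row_oppE) qconj1E; field. Qed.
Lemma qIm2E p : qIm p 0 2 = p 0 2.
Proof. by rewrite !(row_scaleE, row_addE, row_oppE) qconj2E; field. Qed.
Lemma qIm3E p : qIm p 0 3 = p 0 3.
Proof. by rewrite !(row_scaleE, row_addE, row_oppE) qconj3E; field. Qed.

Definition quatE := (row_0E, row_addE, row_oppE, row_scaleE,
  qmul0E, qmul1E, qmul2E, qmul3E, qconj0E, qconj1E, qconj2E, qconj3E,
  qone0E, qone1E, qone2E, qone3E, qIm0E, qIm1E, qIm2E, qIm3E).

End QuaternionComponents.

Ltac quat4 := apply: row4P; rewrite !quatE.

Section QuaternionAlgebra.
Context {R : realType}.
Implicit Types (p q r u v : 'rV[R]_4).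

Lemma qmulA p q r : qmul p (qmul q r) = qmul (qmul p q) r.
Proof. by quat4; ring. Qed.
Lemma qmulDl p q r : qmul (p + q) r = qmul p r + qmul q r.
Proof. by quat4; ring. Qed.
Lemma qmulDr p q r : qmul p (q + r) = qmul p q + qmul p r.
Proof. by quat4; ring. Qed.
Lemma qmulBl p q r : qmul (p - q) r = qmul p r - qmul q r.
Proof. by quat4; ring. Qed.
Lemma qmulBr p q r : qmul p (q - r) = qmul p q - qmul p r.
Proof. by quat4; ring. Qed.
Lemma qmulZl (a : R) p q : qmul (a *: p) q = a *: qmul p q.
Proof. by quat4; ring. Qed.
Lemma qmulZr (a : R) p q : qmul p (a *: q) = a *: qmul p q.
Proof. by quat4; ring. Qed.
Lemma qmul0l p : qmul 0 p = 0.
Proof. by rewrite -(scale0r 0) qmulZl !scale0r. Qed.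
Lemma qmul0r p : qmul p 0 = 0.
Proof. by rewrite -(scale0r 0) qmulZr !scale0r. Qed.
Lemma qmul1r p : qmul p (qone R) = p.
Proof. by quat4; ring. Qed.

Lemma qmul_suml n (F : 'I_n -> 'rV[R]_4) p : qmul (\sum_i F i) p = \sum_i qmul (F i) p.
Proof.
elim/big_rec2: _ => [|i q r _ <-]; first exact: qmul0l.
by rewrite qmulDl.
Qed.
Lemma qmul_sumr n (F : 'I_n -> 'rV[R]_4) p : qmul p (\sum_i F i) = \sum_i qmul p (F i).
Proof.
elim/big_rec2: _ => [|i q r _ <-]; first exact: qmul0r.
by rewrite qmulDr.
Qed.

Lemma sqnormE p : sqnorm p = p 0 0 ^+ 2 + p 0 1 ^+ 2 + p 0 2 ^+ 2 + p 0 3 ^+ 2.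
Proof. exact: sum4E. Qed.

Lemma qmul_conjr p : qmul p (qconj p) = sqnorm p *: qone R.
Proof. by rewrite sqnormE; quat4; ring. Qed.

Lemma sqnorm_qmul p q : sqnorm (qmul p q) = sqnorm p * sqnorm q.
Proof. by rewrite !sqnormE !quatE; ring. Qed.

Lemma sqnorm_qconj p : sqnorm (qconj p) = sqnorm p.
Proof. by rewrite !sqnormE !quatE; ring. Qed.

Lemma qmul_eq0l p q : q != 0 -> qmul p q = 0 -> p = 0.
Proof.
move=> q0 /(congr1 (@sqnorm R 4)); rewrite sqnorm_qmul.
have /eqP -> : sqnorm (0 : 'rV[R]_4) == 0 by rewrite sqnorm_eq0.
by move/eqP; rewrite mulf_eq0 !sqnorm_eq0 (negbTE q0) orbF => /eqP.
Qed.

Lemma innerE p q : inner p q = \sum_k p 0 k * q 0 k.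
Proof.
rewrite sum4E /inner /mxtrace !big_ord_recl !big_ord0 !mxE !big_ord_recl !big_ord0 !mxE /=.
by field.
Qed.

Lemma innerZ (a b : R) p q : inner (a *: p) (b *: q) = a * b * inner p q.
Proof.
rewrite !innerE mulr_sumr; apply: eq_bigr => k _.
by rewrite !mxE; ring.
Qed.

Lemma inner_qmulr p q r : inner (qmul p r) (qmul q r) = sqnorm r * inner p q.
Proof. by rewrite !innerE !sum4E sqnormE !quatE; ring. Qed.

Lemma inner_qmull p q r : inner (qmul r p) (qmul r q) = sqnorm r * inner p q.
Proof. by rewrite !innerE !sum4E sqnormE !quatE; ring. Qed.

(** [imconj x u] is the value on the tangent vector u of the one-form Im(conj(x) dx),
the numerator of the instanton. *)
Definition imconj p u := qIm (qmul (qconj p) u).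

(** The value on (u, v) of the two-form d conj(x) /\ dx. *)
Definition wedge u v := qmul (qconj u) v - qmul (qconj v) u.

Lemma imconj_skew u v : imconj u v - imconj v u = wedge u v.
Proof. by rewrite /imconj /wedge; quat4; ring. Qed.

Lemma imconjDl p q u : imconj (p + q) u = imconj p u + imconj q u.
Proof. by rewrite /imconj /wedge; quat4; ring. Qed.
Lemma imconjZl (a : R) p u : imconj (a *: p) u = a *: imconj p u.
Proof. by rewrite /imconj /wedge; quat4; ring. Qed.

(** The curvature of f Im(conj(x) dx), with f = 1 / (1 + |x|^2), is f^2 times
d conj(x) /\ dx plus f^2 times the left side at x = p: the terms come from
f - f^2 = f^2 |x|^2, from d f = - 2 f^2 <x, dx> and from the commutator. *)
Lemma instanton_identity p u v :
  sqnorm p *: wedge u v - (2 * inner p u) *: imconj p v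
  + (2 * inner p v) *: imconj p u + qbr (imconj p u) (imconj p v) = 0.
Proof. by rewrite /imconj /wedge /qbr !innerE !sum4E sqnormE; quat4; ring. Qed.

(** Quaternionic conjugation turns Im(conj(x) dx) into Im(x d conj(x)), the
numerator of the instanton in the South chart; the flag lets one proof serve both
charts. *)
Definition qflip (b : bool) p := if b then qconj p else p.

Lemma qflipD b p q : qflip b (p + q) = qflip b p + qflip b q.
Proof. by case: b => //=; quat4; ring. Qed.
Lemma qflipZ b (a : R) p : qflip b (a *: p) = a *: qflip b p.
Proof. by case: b => //=; quat4; ring. Qed.
Lemma sqnorm_qflip b p : sqnorm (qflip b p) = sqnorm p.
Proof. by case: b => //=; rewrite sqnorm_qconj. Qed.
Lemma inner_qconj p q : inner (qconj p) (qconj q) = inner p q.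
Proof. by rewrite !innerE !sum4E !quatE; ring. Qed.

Lemma inner_qflip b p q : inner (qflip b p) (qflip b q) = inner p q.
Proof. by case: b; rewrite /qflip ?inner_qconj. Qed.

Lemma inner_evec p i : inner p (evec R i) = p 0 i.
Proof.
have evE k : p 0 k * evec R i 0 k = if k == i then p 0 k else 0.
  by rewrite evecE; case: eqP => _; rewrite ?mulr1 ?mulr0.
by rewrite innerE (eq_bigr _ (fun k _ => evE k)) -big_mkcond big_pred1_eq.
Qed.

Lemma sqnorm_evec i : sqnorm (evec R i) = 1.
Proof.
transitivity (inner (evec R i) (evec R i)); last by rewrite inner_evec evecE eqxx.
by rewrite innerE; apply: eq_bigr => k _; rewrite expr2.
Qed.

(** In the sums over the frame below, the entries of the basis vectors are wanted
only after quaternion products have been expanded; the abstract name e keeps them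
folded until then. *)
Lemma evec_std : exists e : 'I_4 -> 'rV[R]_4, evec R = e /\
  [/\ [/\ e 0 0 0 = 1, e 0 0 1 = 0, e 0 0 2 = 0 & e 0 0 3 = 0],
   [/\ e 1 0 0 = 0, e 1 0 1 = 1, e 1 0 2 = 0 & e 1 0 3 = 0],
   [/\ e 2 0 0 = 0, e 2 0 1 = 0, e 2 0 2 = 1 & e 2 0 3 = 0]
   & [/\ e 3 0 0 = 0, e 3 0 1 = 0, e 3 0 2 = 0 & e 3 0 3 = 1]].
Proof. by exists (evec R); split=> //; split; split; rewrite evecE. Qed.

Ltac evec_components :=
  have [e [-> [[? ? ? ?] [? ? ? ?] [? ? ? ?] [? ? ? ?]]]] := evec_std;
  rewrite sum4E; quat4;
  repeat match goal with H : fun_of_matrix _ _ _ = _ |- _ => rewrite ?H; clear H end;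
  ring.

Lemma sum_frame_conjr b :
  \sum_i qmul (qflip b (evec R i)) (qconj (qflip b (evec R i))) = 4 *: qone R.
Proof. by case: b; rewrite /qflip; evec_components. Qed.

(** Together with the two neighbouring identities, a Casimir-type formula; all
three are independent of the orthonormal frame, hence insensitive to the flip. *)
Lemma sum_frame_sandwich b q :
  \sum_i qmul (qmul (qflip b (evec R i)) q) (qflip b (evec R i)) = (- 2) *: qconj q.
Proof. by case: b; rewrite /qflip; evec_components. Qed.

Lemma sum_frame_conj_sandwich b q :
  \sum_i qmul (qmul (qconj (qflip b (evec R i))) q) (qflip b (evec R i)) =
  2 *: (q + qconj q).
Proof. by case: b; rewrite /qflip; evec_components. Qed.

End QuaternionAlgebra.

(** * Quaternion-valued calculus *)

Section QuaternionCalculus.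
Context {R : realType}.
Implicit Types (F G : 'rV[R]_4 -> 'rV[R]_4) (x : 'rV[R]_4).

Lemma differentiable_qmul F G x : differentiable F x -> differentiable G x ->
  differentiable (fun y => qmul (F y) (G y)) x.
Proof.
move=> /differentiable_mxP dF /differentiable_mxP dG.
have d a b : differentiable (fun y => F y 0 a * G y 0 b : R^o) x.
  exact: (differentiableM (dF _ _) (dG _ _)).
apply/differentiable_mxP => a [[|[|[|[|//]]]] k4]; under eq_fun do rewrite mxE /=.
- exact: (differentiableB (differentiableB (differentiableB (d 0 0) (d 1 1)) (d 2 2)) (d 3 3)).
- exact: (differentiableB (differentiableD (differentiableD (d 0 1) (d 1 0)) (d 2 3)) (d 3 2)).
- exact: (differentiableD (differentiableD (differentiableB (d 0 2) (d 1 3)) (d 2 0)) (d 3 1)).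
- exact: (differentiableD (differentiableB (differentiableD (d 0 3) (d 1 2)) (d 2 1)) (d 3 0)).
Qed.

Lemma partial_qmul F G i x : differentiable F x -> differentiable G x ->
  partial i (fun y => qmul (F y) (G y)) x =
  qmul (partial i F x) (G x) + qmul (F x) (partial i G x).
Proof.
move=> dF dG; have /differentiable_mxP dFc := dF; have /differentiable_mxP dGc := dG.
pose P (f : 'rV[R]_4 -> R^o) l := differentiable f x /\ partial i f x = l.
have PD f g lf lg : P f lf -> P g lg -> P (fun y => f y + g y) (lf + lg).
  by move=> [df <-] [dg <-]; split; [exact: differentiableD|exact: partialD].
have PB f g lf lg : P f lf -> P g lg -> P (fun y => f y - g y) (lf - lg).
  by move=> [df <-] [dg <-]; split; [exact: differentiableB|exact: partialB].
have PM a b : P (fun y => F y 0 a * G y 0 b)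
    (partial i F x 0 a * G x 0 b + F x 0 a * partial i G x 0 b).
  split; first exact: (differentiableM (dFc _ _) (dGc _ _)).
  by rewrite (partialM _ (dFc _ _) (dGc _ _)) !partial_mxE.
apply: row4P; rewrite (partial_mxE _ _ _ (differentiable_qmul dF dG));
  under eq_fun do rewrite !quatE.
- rewrite (PB _ _ _ _ (PB _ _ _ _ (PB _ _ _ _ (PM 0 0) (PM 1 1)) (PM 2 2)) (PM 3 3)).2.
  by rewrite !quatE; ring.
- rewrite (PB _ _ _ _ (PD _ _ _ _ (PD _ _ _ _ (PM 0 1) (PM 1 0)) (PM 2 3)) (PM 3 2)).2.
  by rewrite !quatE; ring.
- rewrite (PD _ _ _ _ (PD _ _ _ _ (PB _ _ _ _ (PM 0 2) (PM 1 3)) (PM 2 0)) (PM 3 1)).2.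
  by rewrite !quatE; ring.
- rewrite (PD _ _ _ _ (PB _ _ _ _ (PD _ _ _ _ (PM 0 3) (PM 1 2)) (PM 2 1)) (PM 3 0)).2.
  by rewrite !quatE; ring.
Qed.

Lemma differentiable_qbr F G x : differentiable F x -> differentiable G x ->
  differentiable (fun y => qbr (F y) (G y)) x.
Proof.
move=> dF dG; exact: (differentiableB (differentiable_qmul dF dG) (differentiable_qmul dG dF)).
Qed.

Lemma partial_qbr F G i x : differentiable F x -> differentiable G x ->
  partial i (fun y => qbr (F y) (G y)) x =
  qbr (partial i F x) (G x) + qbr (F x) (partial i G x).
Proof.
move=> dF dG.
rewrite (partialB _ (differentiable_qmul dF dG) (differentiable_qmul dG dF)).
by rewrite !partial_qmul// /qbr opprD [- _ - _]addrC !addrA -!addrA; congr (_ + _); rewrite addrCA.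
Qed.

Lemma differentiable_row_linear n (L : 'rV[R]_4 -> 'rV[R]_n) x :
  (forall p q, L (p + q) = L p + L q) -> (forall (a : R) p, L (a *: p) = a *: L p) ->
  differentiable L x.
Proof.
move=> LD LZ.
have -> : L = \sum_i (fun y : 'rV[R]_4 => y 0 i *: L (evec R i)).
  apply/funext => y; rewrite fct_sumE {1}(row_sum_delta y).
  by rewrite [in LHS]sum4E !LD !LZ [RHS]sum4E.
apply: differentiable_sum => i.
by apply: differentiable_scale => //; exact: differentiable_coord.
Qed.

Lemma partial_row_linear n (L : 'rV[R]_4 -> 'rV[R]_n) i x :
  (forall p q, L (p + q) = L p + L q) -> (forall (a : R) p, L (a *: p) = a *: L p) ->
  partial i L x = L (evec R i).
Proof.
move=> LD LZ.
have dL k : differentiable (fun y : 'rV[R]_4 => y 0 k *: L (evec R k)) x.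
  by apply: differentiable_scale => //; exact: differentiable_coord.
have -> : L = (fun y : 'rV[R]_4 => \sum_i y 0 i *: L (evec R i)).
  apply/funext => y; rewrite {1}(row_sum_delta y).
  by rewrite [in LHS]sum4E !LD !LZ [RHS]sum4E.
rewrite partial_sum//.
under eq_bigr => k _ do rewrite (partialZ _ (differentiable_coord _ _ _))//
  partial_cst scaler0 addr0 partial_coord.
under [RHS]eq_bigr => k _ do rewrite evecE eq_sym.
by [].
Qed.

End QuaternionCalculus.

(** * Quaternion identities behind the instanton *)

Section InstantonAlgebra.
Context {R : realType}.
Implicit Types (p q r u v : 'rV[R]_4).
Lemma qbr_Im p q : qbr (qIm p) q = qbr p q.
Proof. by rewrite /qbr; quat4; ring. Qed.

Lemma qconjK p : qconj (qconj p) = p.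
Proof. by quat4; ring. Qed.
Lemma qconjM p q : qconj (qmul p q) = qmul (qconj q) (qconj p).
Proof. by quat4; ring. Qed.

(** Expanding the commutator, where Im may be dropped, leaves four sums over the
frame, each of them evaluated by a frame identity. *)
Lemma instanton_divergence b p u :
  \sum_i qbr (imconj p (qflip b (evec R i))) (wedge (qflip b (evec R i)) u) = 4 *: wedge p u.
Proof.
set E := fun i => qflip b (evec R i).
have termE i : qbr (imconj p (E i)) (wedge (E i) u) =
    qmul (qmul (qconj p) (qmul (E i) (qconj (E i)))) u
    - qmul (qconj p) (qmul (qmul (E i) (qconj u)) (E i))
    - qmul (qmul (qconj (E i)) (qmul u (qconj p))) (E i)
    + qmul (qconj u) (qmul (qmul (E i) (qconj p)) (E i)).
  rewrite /imconj qbr_Im /qbr /wedge qmulBl qmulBr !qmulA.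
  by rewrite opprB addrA addrAC -!addrA.
rewrite (eq_bigr _ (fun i _ => termE i)) big_split sumrB sumrB /=.
have -> : \sum_i qmul (qmul (qconj p) (qmul (E i) (qconj (E i)))) u = 4 *: qmul (qconj p) u.
  by rewrite -qmul_suml -qmul_sumr sum_frame_conjr qmulZr qmulZl qmul1r.
have -> : \sum_i qmul (qconj p) (qmul (qmul (E i) (qconj u)) (E i)) =
    (- 2) *: qmul (qconj p) u.
  by rewrite -qmul_sumr sum_frame_sandwich qmulZr qconjK.
have -> : \sum_i qmul (qconj u) (qmul (qmul (E i) (qconj p)) (E i)) =
    (- 2) *: qmul (qconj u) p.
  by rewrite -qmul_sumr sum_frame_sandwich qmulZr qconjK.
rewrite sum_frame_conj_sandwich qconjM qconjK /wedge.
by quat4; ring.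
Qed.

(** The curvature two-form takes orthogonal frame vectors u, v to 2 conj(u) v, so
up to the factor 4 its inner products are those of a Euclidean bivector algebra;
with a common second argument no self-duality correction appears. *)
Lemma inner_wedge_wedge u v w :
  inner (wedge u w) (wedge v w) = 4 * (inner u v * sqnorm w - inner u w * inner v w).
Proof. by rewrite !innerE !sum4E sqnormE /wedge !quatE; ring. Qed.

Lemma inner_wedge b i j :
  \sum_p inner (wedge (qflip b (evec R i)) (qflip b (evec R p)))
               (wedge (qflip b (evec R j)) (qflip b (evec R p))) = 12 * (i == j)%:R.
Proof.
under eq_bigr => p _ do
  rewrite inner_wedge_wedge !inner_qflip !inner_evec sqnorm_qflip sqnorm_evec mulr1 !evecE.
rewrite sum4E.
case: i => [[|[|[|[|//]]]] i4]; case: j => [[|[|[|[|//]]]] j4]; rewrite /=; ring.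
Qed.

End InstantonAlgebra.

(** * The round metric *)

Section RoundGeometry.
Context {R : realType}.
Implicit Types (a : R) (x y : 'rV[R]_4) (i j k l : 'I_4) (c : chart).

(** The conformal factor up to the constant 2 a. *)
Definition conf x : R := (1 + sqnorm x)^-1.

Lemma conf_gt0 x : 0 < conf x.
Proof. by rewrite invr_gt0 ltr_pwDl// sqnorm_ge0. Qed.

Lemma conf_neq0 x : conf x != 0. Proof. by rewrite gt_eqF// conf_gt0. Qed.

Lemma conf_sqnorm x : conf x * sqnorm x = 1 - conf x.
Proof.
have s1 : 1 + sqnorm x != 0 by rewrite gt_eqF// ltr_pwDl// sqnorm_ge0.
by rewrite /conf; field.
Qed.

Lemma differentiable_conf x : differentiable (conf : 'rV[R]_4 -> R^o) x.
Proof.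
apply: differentiableV; last by rewrite gt_eqF// ltr_pwDl// sqnorm_ge0.
exact: (differentiableD (differentiable_cst _ _) (differentiable_sqnorm x)).
Qed.

Lemma partial_conf i x :
  partial i (conf : 'rV[R]_4 -> R^o) x = - (2 * x 0 i * conf x ^+ 2).
Proof.
rewrite (partialV i
  (differentiableD (differentiable_cst (1 : R^o) x) (differentiable_sqnorm x))) /=;
  last by rewrite gt_eqF// ltr_pwDl// sqnorm_ge0.
rewrite (partialD i (differentiable_cst (1 : R^o) x) (differentiable_sqnorm x)).
rewrite partial_cst add0r partial_sqnorm mulNr mulrC /conf -exprVn.
by [].
Qed.

Lemma differentiable_confX n x :
  differentiable (fun y : 'rV[R]_4 => conf y ^+ n : R^o) x.
Proof.
elim: n => [|n IH]; first by under eq_fun do rewrite expr0; exact: differentiable_cst.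
under eq_fun do rewrite exprS.
exact: (differentiableM (differentiable_conf x) IH).
Qed.

Lemma partial_confX n i x : partial i (fun y => conf y ^+ n : R^o) x =
  - (n%:R * 2 * x 0 i * conf x ^+ n.+1).
Proof.
elim: n => [|n IH].
  by under eq_fun do rewrite expr0; rewrite partial_cst !mul0r oppr0.
under eq_fun do rewrite exprS.
rewrite (partialM i (differentiable_conf x) (differentiable_confX n x)) IH.
by rewrite partial_conf !exprS -natr1; ring.
Qed.

(** The sign of the fifth coordinate of the sphere in the given chart, which is
this sign times 1 - 2 f = (|x|^2 - 1) / (|x|^2 + 1). *)
Definition height c : R := if c is North then 1 else - 1.

Lemma height_sqr c : height c ^+ 2 = 1.
Proof. by case: c; rewrite /height ?sqrrN expr1n. Qed.

Lemma stereoL c x k : stereo c x 0 (lshift 1 k) = conf x * x 0 k * 2.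
Proof. by rewrite /stereo -/(conf x) scale_row_mx row_mxEl !mxE; ring. Qed.

Lemma stereoR c x (k : 'I_1) : stereo c x 0 (rshift 4 k) = height c * (1 - 2 * conf x).
Proof.
have -> : 1 - 2 * conf x = conf x * sqnorm x - conf x by rewrite conf_sqnorm; ring.
by rewrite /stereo -/(conf x) scale_row_mx row_mxEr !mxE; case: c; rewrite /height; ring.
Qed.

Lemma differentiable_stereo c x : differentiable (stereo c) x.
Proof.
apply/differentiable_mxP => a b; rewrite (ord1 a).
case: (split_ordP b) => k ->.
  under eq_fun do rewrite stereoL.
  exact: (differentiableM (differentiableM (differentiable_conf x)
    (differentiable_coord x 0 k)) (differentiable_cst (2 : R^o) x)).
under eq_fun do rewrite stereoR.
exact: (differentiableM (differentiable_cst (height c : R^o) x)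
  (differentiableB (differentiable_cst (1 : R^o) x)
    (differentiableM (differentiable_cst (2 : R^o) x) (differentiable_conf x)))).
Qed.

Lemma partial_stereoL c i k x : (partial i (stereo c) x) 0 (lshift 1 k) =
  2 * conf x * (i == k)%:R - 4 * x 0 i * x 0 k * conf x ^+ 2.
Proof.
rewrite (partial_mxE _ _ _ (differentiable_stereo c x)).
under eq_fun do rewrite stereoL.
rewrite (partialM i (differentiableM (differentiable_conf x)
    (differentiable_coord x 0 k)) (differentiable_cst (2 : R^o) x)).
rewrite (partialM i (differentiable_conf x) (differentiable_coord x 0 k)).
by rewrite partial_coord partial_conf partial_cst; ring.
Qed.

Lemma partial_stereoR c i (k : 'I_1) x : (partial i (stereo c) x) 0 (rshift 4 k) =
  height c * 4 * x 0 i * conf x ^+ 2.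
Proof.
rewrite (partial_mxE _ _ _ (differentiable_stereo c x)).
under eq_fun do rewrite stereoR.
have d2 := differentiableM (differentiable_cst (2 : R^o) x) (differentiable_conf x).
rewrite (partialM i (differentiable_cst (height c : R^o) x)
  (differentiableB (differentiable_cst (1 : R^o) x) d2)).
rewrite (partialB i (differentiable_cst (1 : R^o) x) d2).
rewrite (partialM i (differentiable_cst (2 : R^o) x) (differentiable_conf x)).
by rewrite !partial_cst partial_conf mul0r /=; ring.
Qed.

(** The sphere is embedded by x -> (2 f x, +-(1 - 2 f)). The cross terms cancel
because f |x|^2 = 1 - f. *)
Lemma round_metricE a c x : round_metric a c x = (4 * a ^+ 2 * conf x ^+ 2)%:M.
Proof.
apply/matrixP => i j; rewrite mxE mxE big_split_ord /= big_ord1.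
have prodE (u v : 'rV[R]_(4 + 1)) (k : 'I_(4 + 1)) :
    (a *: u) 0 k * (a *: v)^T k 0 = a * u 0 k * (a * v 0 k) by rewrite !mxE.
have S k : ((a *: partial i (stereo c) x) 0 (lshift 1 k)) *
    ((a *: partial j (stereo c) x)^T (lshift 1 k) 0) =
    4 * a ^+ 2 * conf x ^+ 2 * ((i == k)%:R * (j == k)%:R)
    - 8 * a ^+ 2 * conf x ^+ 3 * (x 0 i * ((j == k)%:R * x 0 k) + x 0 j * ((i == k)%:R * x 0 k))
    + 16 * a ^+ 2 * conf x ^+ 4 * x 0 i * x 0 j * x 0 k ^+ 2.
  rewrite prodE.
  have L m := congr1 ( *%R a) (partial_stereoL c m k x).
  apply: etrans (congr2 *%R (L i) (L j)) _.
  ring.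
have delta_sum (F : 'I_4 -> R) l : \sum_k (l == k)%:R * F k = F l.
  rewrite (bigD1 l)//= big1 ?eqxx ?mul1r ?addr0// => k /negbTE.
  by rewrite eq_sym => ->; rewrite mul0r.
rewrite (eq_bigr _ (fun k _ => S k)) big_split sumrB /= -!mulr_sumr big_split /=.
rewrite -!mulr_sumr !delta_sum -/(sqnorm x) prodE.
have L m := congr1 ( *%R a) (partial_stereoR c m 0 x).
rewrite [X in _ + X](congr2 *%R (L i) (L j)) [RHS]mxE.
have -> : conf x ^+ 4 = conf x ^+ 3 * conf x by rewrite -exprSr.
rewrite [j == i]eq_sym -mulrnAr.
have -> : a * (height c * 4 * x 0 i * conf x ^+ 2) * (a * (height c * 4 * x 0 j * conf x ^+ 2))
  = height c ^+ 2 * (16 * a ^+ 2 * x 0 i * x 0 j * (conf x ^+ 4)) by ring.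
rewrite height_sqr mulr_natr.
have e := conf_sqnorm x.
have -> : 16 * a ^+ 2 * (conf x ^+ 3 * conf x) * x 0 i * x 0 j * sqnorm x =
  16 * a ^+ 2 * conf x ^+ 3 * x 0 i * x 0 j * (conf x * sqnorm x) by ring.
rewrite e; ring.
Qed.

Lemma round_metric_scale a c :
  round_metric a c = fun y => (4 * a ^+ 2 * conf y ^+ 2) *: 1%:M.
Proof. by apply/funext => y; rewrite round_metricE scalemx1. Qed.

Lemma differentiable_round_factor a x :
  differentiable (fun y : 'rV[R]_4 => 4 * a ^+ 2 * conf y ^+ 2 : R^o) x.
Proof.
exact: (differentiableM (differentiable_cst (4 * a ^+ 2 : R^o) x) (differentiable_confX 2 x)).
Qed.

Lemma partial_round_factor a i x :
  partial i (fun y => 4 * a ^+ 2 * conf y ^+ 2 : R^o) x =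
  - (16 * a ^+ 2 * x 0 i * conf x ^+ 3).
Proof.
rewrite (partialM i (differentiable_cst (4 * a ^+ 2 : R^o) x) (differentiable_confX 2 x)).
by rewrite partial_cst partial_confX /=; ring.
Qed.

Lemma dg_round a c i j k x :
  dg (round_metric a c) i j k x = - (16 * a ^+ 2 * x 0 i * conf x ^+ 3) * (j == k)%:R.
Proof.
rewrite /dg round_metric_scale (partialZ i (differentiable_round_factor a x)); last by [].
by rewrite partial_cst scaler0 addr0 partial_round_factor !mxE.
Qed.

Lemma invmx_round a c x : a != 0 ->
  invmx (round_metric a c x) = (4 * a ^+ 2 * conf x ^+ 2)^-1%:M.
Proof. by move=> a0; rewrite round_metricE invmx_scalar. Qed.

Lemma christoffel_round a c k i j x : a != 0 ->
  christoffel (round_metric a c) k i j x =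
  - (2 * conf x * (x 0 i * (k == j)%:R + x 0 j * (k == i)%:R - x 0 k * (i == j)%:R)).
Proof.
move=> a0; rewrite /christoffel invmx_round//.
rewrite (bigD1 k)//= big1 => [|l /negbTE lk]; last by rewrite mxE eq_sym lk mulr0n mul0r.
rewrite mxE eqxx mulr1n !dg_round [j == k]eq_sym [i == k]eq_sym.
by field; rewrite conf_neq0 a0.
Qed.

End RoundGeometry.

Section RoundCurvature.
Context {R : realType}.
Implicit Types (a : R) (x y : 'rV[R]_4) (i j k l m : 'I_4) (c : chart).

(** The Levi-Civita connection of exp(2 phi) times the Euclidean metric has
Gamma^k_ij = delta_kj d_i phi + delta_ki d_j phi - delta_ij d_k phi; here
phi = log f + const and d phi = - 2 f x, so Gamma = - 2 f [conf_gamma]. The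
derivative of the linear function [conf_gamma k i j] in direction m is
[dconf_gamma m k i j]. *)
Definition conf_gamma k i j x : R :=
  x 0 i * (k == j)%:R + x 0 j * (k == i)%:R - x 0 k * (i == j)%:R.

Definition dconf_gamma m k i j : R :=
  (m == i)%:R * (k == j)%:R + (m == j)%:R * (k == i)%:R - (m == k)%:R * (i == j)%:R.

Lemma partial_coordM m i (b : R) x :
  differentiable (fun y : 'rV[R]_4 => y 0 i * b : R^o) x /\
  partial m (fun y => y 0 i * b : R^o) x = (m == i)%:R * b.
Proof.
split; first exact: (differentiableM (differentiable_coord x 0 i) (differentiable_cst (b : R^o) x)).
rewrite (partialM m (differentiable_coord x 0 i) (differentiable_cst (b : R^o) x)).
by rewrite partial_coord partial_cst mulr0 addr0.
Qed.

Lemma differentiable_conf_gamma k i j x : differentiable (conf_gamma k i j : 'rV[R]_4 -> R^o) x.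
Proof.
exact: (differentiableB (differentiableD (partial_coordM 0 i _ x).1
   (partial_coordM 0 j _ x).1) (partial_coordM 0 k _ x).1).
Qed.

Lemma partial_conf_gamma m k i j x :
  partial m (conf_gamma k i j : 'rV[R]_4 -> R^o) x = dconf_gamma m k i j.
Proof.
have d1 := (partial_coordM m i (k == j)%:R x).1.
have d2 := (partial_coordM m j (k == i)%:R x).1.
have d3 := (partial_coordM m k (i == j)%:R x).1.
rewrite (partialB m (differentiableD d1 d2) d3) (partialD m d1 d2).
by rewrite !(partial_coordM m _ _ x).2.
Qed.

Lemma christoffel_conf_gamma a c k i j : a != 0 ->
  christoffel (round_metric a c) k i j = fun x => - 2 * (conf x * conf_gamma k i j x).
Proof.
by move=> a0; apply/funext => x; rewrite christoffel_round// /conf_gamma; ring.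
Qed.

Lemma partial_christoffel a c m k i j x : a != 0 ->
  partial m (christoffel (round_metric a c) k i j : 'rV[R]_4 -> R^o) x =
  4 * conf x ^+ 2 * x 0 m * conf_gamma k i j x - 2 * conf x * dconf_gamma m k i j.
Proof.
move=> a0; rewrite christoffel_conf_gamma//.
have d := differentiableM (differentiable_conf x) (differentiable_conf_gamma k i j x).
rewrite (partialM m (differentiable_cst (- 2 : R^o) x) d).
rewrite (partialM m (differentiable_conf x) (differentiable_conf_gamma k i j x)).
by rewrite partial_cst partial_conf_gamma partial_conf /=; ring.
Qed.

(** The left side is the Ricci tensor with f and d f = - 2 f^2 x treated as free
quantities; only afterwards f |x|^2 = 1 - f turns the right side into 12 f^2. *)
Lemma conf_gamma_trace_identity (f : R) j k x :
  \sum_i ((4 * f ^+ 2 * x 0 i * conf_gamma i j k x - 2 * f * dconf_gamma i i j k)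
         - (4 * f ^+ 2 * x 0 j * conf_gamma i i k x - 2 * f * dconf_gamma j i i k))
   + \sum_i \sum_l ((- 2 * (f * conf_gamma i i l x)) * (- 2 * (f * conf_gamma l j k x))
                    - (- 2 * (f * conf_gamma i j l x)) * (- 2 * (f * conf_gamma l i k x)))
  = 12 * (f - f * (f * sqnorm x)) * (j == k)%:R.
Proof.
rewrite sqnormE !sum4E /conf_gamma /dconf_gamma.
by elim/ord4_ind: j; elim/ord4_ind: k; rewrite /= ?mulr1n ?mulr0n; ring.
Qed.

Lemma ricci_round a c x : a != 0 ->
  ricci (round_metric a c) x = (12 * conf x ^+ 2)%:M.
Proof.
move=> a0; apply/matrixP => j k; rewrite !mxE.
under eq_bigr => i _ do rewrite !partial_christoffel//.
under [X in _ + X]eq_bigr => i _ do under eq_bigr => l _ do rewrite !christoffel_conf_gamma//.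
rewrite conf_gamma_trace_identity conf_sqnorm -mulr_natr.
by ring.
Qed.

End RoundCurvature.

Section SmoothMetric.
Context {R : realType}.
Implicit Types (x y : 'rV[R]_4) (i j k l : 'I_4).

(** The polynomials in the coordinates and in f form an algebra of differentiable
functions that is stable under partial derivatives, since
d_i f = - 2 x_i f^2; so all of them are smooth. *)
Inductive conf_poly : ('rV[R]_4 -> R) -> Prop :=
| ConfPolyCst (b : R) : conf_poly (fun=> b)
| ConfPolyCoord i : conf_poly (fun x => x 0 i)
| ConfPolyConf : conf_poly conf
| ConfPolyD f g : conf_poly f -> conf_poly g -> conf_poly (fun x => f x + g x)
| ConfPolyM f g : conf_poly f -> conf_poly g -> conf_poly (fun x => f x * g x).

Lemma differentiable_conf_poly f : conf_poly f ->
  forall x, differentiable (f : 'rV[R]_4 -> R^o) x.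
Proof.
elim=> [b|i||{}f g _ df _ dg|{}f g _ df _ dg] x.
- exact: differentiable_cst.
- exact: differentiable_coord.
- exact: differentiable_conf.
- exact: (differentiableD (df x) (dg x)).
- exact: (differentiableM (df x) (dg x)).
Qed.

Lemma conf_poly_partial i f : conf_poly f -> conf_poly (partial i (f : 'rV[R]_4 -> R^o)).
Proof.
elim=> [b|j||{}f g pf df pg dg|{}f g pf df pg dg].
- rewrite (_ : partial i _ = fun=> (0 : R^o)); first exact: ConfPolyCst.
  by apply/funext => x; rewrite partial_cst.
- rewrite (_ : partial i _ = fun=> ((i == j)%:R : R^o)); first exact: ConfPolyCst.
  by apply/funext => x; rewrite partial_coord.
- rewrite (_ : partial i _ = fun x => (- 2) * (x 0 i * (conf x * conf x)) : R^o).
    apply: ConfPolyM; first exact: ConfPolyCst.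
    apply: ConfPolyM; first exact: ConfPolyCoord.
    by apply: ConfPolyM; exact: ConfPolyConf.
  by apply/funext => x; rewrite partial_conf; ring.
- rewrite (_ : partial i _ = fun x => partial i (f : _ -> R^o) x + partial i (g : _ -> R^o) x : R^o).
    exact: ConfPolyD.
  apply/funext => x.
  by rewrite (partialD i (differentiable_conf_poly pf x) (differentiable_conf_poly pg x)).
- rewrite (_ : partial i _ = fun x => partial i (f : _ -> R^o) x * g x
      + f x * partial i (g : _ -> R^o) x : R^o).
    by apply: ConfPolyD; exact: ConfPolyM.
  apply/funext => x.
  by rewrite (partialM i (differentiable_conf_poly pf x) (differentiable_conf_poly pg x)).
Qed.

Lemma smooth_conf_poly m n (M : 'rV[R]_4 -> 'M[R]_(m, n)) :
  (forall a b, conf_poly (fun x => M x a b)) -> smooth_on setT M.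
Proof.
move=> pM.
have entrywise (N : 'rV[R]_4 -> 'M[R]_(m, n)) :
    (forall a b, conf_poly (fun x => N x a b)) -> forall x, differentiable N x.
  move=> pN x; apply/differentiable_mxP => a b.
  exact: (differentiable_conf_poly (pN a b)).
move=> s x _; apply: (entrywise) => {x}; elim: s => [//|k s IH] a b /=.
set N := foldr _ _ _ in IH *.
rewrite (_ : (fun x => _) = partial k (fun x => N x a b : R^o)).
  exact: conf_poly_partial.
by apply/funext => x; exact: (partial_mxE k a b (entrywise N IH x)).
Qed.

Lemma smooth_round (a : R) c : smooth_on setT (round_metric a c).
Proof.
apply: smooth_conf_poly => i j.
rewrite (_ : (fun x => _) = fun x => (4 * a ^+ 2 * (i == j)%:R) * (conf x * conf x)).
  by do 2 (apply: ConfPolyM; do ?[exact: ConfPolyCst|exact: ConfPolyConf]).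
by apply/funext => x; rewrite round_metricE mxE -(mulr_natr (_ * _)); ring.
Qed.

End SmoothMetric.

(** * Yang-Mills theory on the round sphere *)

Section ConformalYangMills.
Context {R : realType}.
Implicit Types (a : R) (x y : 'rV[R]_4) (i j k l m : 'I_4) (c : chart) (A : lform R).

(** The covariant divergence of the curvature with respect to the flat metric. *)
Definition flat_div A j x : 'rV[R]_4 :=
  \sum_i (partial i (curvature A i j) x + qbr (A i x) (curvature A i j x)).

Lemma sum_scalar_mx (V : lmodType R) n (b : R) (F : 'I_n -> V) (i : 'I_n) :
  \sum_k (b%:M : 'M[R]_n) i k *: F k = b *: F i.
Proof.
rewrite (bigD1 i)//= big1 ?addr0 => [|k /negbTE ki]; first by rewrite mxE eqxx.
by rewrite mxE eq_sym ki scale0r.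
Qed.

(** The conformal invariance of the Yang-Mills equation in dimension four. With
F_ij = G_ij - G_ji antisymmetric, the first trace of Gamma contributes
(2 - n) d phi contracted with F and the second 2 d phi contracted with F, where
n = 4. *)
Lemma conf_gamma_contraction (G : 'I_4 -> 'I_4 -> R) j x :
  \sum_i \sum_l (conf_gamma l i i x * (G l j - G j l) + conf_gamma l i j x * (G i l - G l i)) = 0.
Proof.
rewrite !sum4E /conf_gamma.
by elim/ord4_ind: j; rewrite /= ?mulr1n ?mulr0n; ring.
Qed.

Lemma christoffel_contraction a c A j x : a != 0 ->
  \sum_i \sum_l (christoffel (round_metric a c) l i i x *: curvature A l j x
               + christoffel (round_metric a c) l i j x *: curvature A i l x) = 0.
Proof.
move=> a0; pose G i j := partial i (A j) x + qmul (A i x) (A j x).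
have FE i k : curvature A i k x = G i k - G k i.
  by rewrite /curvature /G /qbr opprD !addrA [_ + _ - partial _ _ _]addrAC.
apply/rowP => q; rewrite summxE mxE.
have comp (u v p w : 'rV[R]_4) (b d : R) :
    (b *: (u - v) + d *: (p - w)) 0 q = b * (u 0 q - v 0 q) + d * (p 0 q - w 0 q).
  by rewrite !mxE.
have termE i l : (christoffel (round_metric a c) l i i x *: curvature A l j x
      + christoffel (round_metric a c) l i j x *: curvature A i l x) 0 q =
    - 2 * conf x * (conf_gamma l i i x * (G l j 0 q - G j l 0 q)
                    + conf_gamma l i j x * (G i l 0 q - G l i 0 q)).
  by rewrite !FE comp !christoffel_conf_gamma//; ring.
under eq_bigr => i _.
  rewrite summxE; under eq_bigr => l _ do rewrite termE.
  rewrite -mulr_sumr; over.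
by rewrite -mulr_sumr (conf_gamma_contraction (fun i k => G i k 0 q)) mulr0.
Qed.

Lemma Dstar_round a c A j x : a != 0 ->
  Dstar (round_metric a c) A j x = - (4 * a ^+ 2 * conf x ^+ 2)^-1 *: flat_div A j x.
Proof.
move=> a0; rewrite /Dstar invmx_round//.
under eq_bigr => i _ do rewrite sum_scalar_mx.
rewrite -scaler_sumr scaleNr; congr (- (_ *: _)).
rewrite /covF /flat_div sumrB christoffel_contraction// subr0.
by [].
Qed.

Lemma Zform_round a c A x : a != 0 ->
  Zform (round_metric a c) A x = \matrix_(i, j) ((4 * a ^+ 2 * conf x ^+ 2)^-1
    * \sum_p inner (curvature A i p x) (curvature A j p x)).
Proof.
move=> a0; apply/matrixP => i j; rewrite !mxE invmx_round// mulr_sumr.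
apply: eq_bigr => p _.
exact: (sum_scalar_mx _ (fun q => inner (curvature A i p x) (curvature A j q x) : R^o) p).
Qed.

End ConformalYangMills.

(** * The instanton in stereographic coordinates *)

Section Instanton.
Context {R : realType}.
Implicit Types (a : R) (x y : 'rV[R]_4) (i j k l m : 'I_4) (b : bool).

Local Notation frame b i := (qflip b (evec R i)).

(** The instanton for b = false; for b = true its pullback by quaternionic
conjugation, Im(x d conj(x)) / (1 + |x|^2). *)
Definition bpst b : lform R := fun i x => conf x *: imconj (qflip b x) (frame b i).

Lemma instantonE i x : instanton i x = bpst false i x.
Proof.
rewrite /instanton /bpst -/(conf x) /imconj /=.
by apply: row4P; rewrite !quatE ?mulr0.
Qed.

Lemma differentiable_imconj b u x : differentiable (fun y => imconj (qflip b y) u) x.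
Proof.
apply: differentiable_row_linear => [p q|t p]; first by rewrite qflipD imconjDl.
by rewrite qflipZ imconjZl.
Qed.

Lemma partial_imconj b u i x :
  partial i (fun y => imconj (qflip b y) u) x = imconj (frame b i) u.
Proof.
apply: (@partial_row_linear _ 4 (fun y => imconj (qflip b y) u)) => [p q|t p].
  by rewrite qflipD imconjDl.
by rewrite qflipZ imconjZl.
Qed.

Lemma differentiable_bpst b j x : differentiable (bpst b j) x.
Proof.
exact: differentiable_scale (differentiable_conf x) (differentiable_imconj b (frame b j) x).
Qed.

Lemma partial_bpst b i j x : partial i (bpst b j) x =
  - (2 * x 0 i * conf x ^+ 2) *: imconj (qflip b x) (frame b j)
  + conf x *: imconj (frame b i) (frame b j).
Proof.
rewrite /bpst (partialZ i (differentiable_conf x) (differentiable_imconj b (frame b j) x)).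
by rewrite partial_conf partial_imconj.
Qed.

Lemma qbrZ (s t : R) (p q : 'rV[R]_4) : qbr (s *: p) (t *: q) = (s * t) *: qbr p q.
Proof. by rewrite /qbr !qmulZl !qmulZr !scalerA scalerBr [t * s]mulrC. Qed.

(** The linear algebra of [curvature_bpst], with the values of the one-form, its
derivatives and its commutator as unknowns: f = f^2 + f^2 s separates the part
that the instanton identity kills from f^2 W. *)
Lemma curvature_assembly (W Li Lj Mij Mji Q : 'rV[R]_4) (s f ti tj : R) :
  Mij - Mji = W -> s *: W - (2 * ti) *: Lj + (2 * tj) *: Li + Q = 0 -> f * s = 1 - f ->
  - (2 * ti * f ^+ 2) *: Lj + f *: Mij - (- (2 * tj * f ^+ 2) *: Li + f *: Mji)
    + (f * f) *: Q = f ^+ 2 *: W.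
Proof.
move=> <- /eqP; rewrite addrC addr_eq0 => /eqP -> fs.
apply/rowP => q; rewrite !(row_addE, row_oppE, row_scaleE).
have {2 4}-> : f = f ^+ 2 + f * (f * s) by rewrite fs; ring.
ring.
Qed.

Lemma curvature_bpst b i j x :
  curvature (bpst b) i j x = conf x ^+ 2 *: wedge (frame b i) (frame b j).
Proof.
rewrite /curvature !partial_bpst /bpst qbrZ.
apply: curvature_assembly (imconj_skew _ _) _ (conf_sqnorm x).
have := instanton_identity (qflip b x) (frame b i) (frame b j).
by rewrite !inner_qflip !inner_evec sqnorm_qflip.
Qed.

Lemma wedgeDl (p q u : 'rV[R]_4) : wedge (p + q) u = wedge p u + wedge q u.
Proof. by rewrite /wedge; apply: row4P; rewrite !quatE; ring. Qed.
Lemma wedgeZl (t : R) (p u : 'rV[R]_4) : wedge (t *: p) u = t *: wedge p u.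
Proof. by rewrite /wedge; apply: row4P; rewrite !quatE; ring. Qed.

(** F_ij = f^2 W_ij with W constant, so the derivative term is
- 4 f^3 sum_i x_i W_ij and the commutator term is its opposite by
[instanton_divergence]. *)
Lemma flat_div_bpst b j x : flat_div (bpst b) j x = 0.
Proof.
rewrite /flat_div.
have FE i : curvature (bpst b) i j = fun y => conf y ^+ 2 *: wedge (frame b i) (frame b j).
  by apply/funext => y; exact: curvature_bpst.
have termE i : partial i (curvature (bpst b) i j) x + qbr (bpst b i x) (curvature (bpst b) i j x)
    = - (4 * conf x ^+ 3) *: (x 0 i *: wedge (frame b i) (frame b j))
    + conf x ^+ 3 *: qbr (imconj (qflip b x) (frame b i)) (wedge (frame b i) (frame b j)).
  rewrite FE (partialZ i (differentiable_confX 2 x)); last by [].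
  rewrite partial_cst scaler0 addr0 partial_confX /bpst qbrZ -exprS scalerA.
  by congr (_ *: _ + _); ring.
rewrite (eq_bigr _ (fun i _ => termE i)) big_split /= -!scaler_sumr.
rewrite instanton_divergence.
have -> : \sum_i x 0 i *: wedge (frame b i) (frame b j) = wedge (qflip b x) (frame b j).
  rewrite {2}(row_sum_delta x) [in RHS]sum4E !qflipD !qflipZ.
  by rewrite !wedgeDl !wedgeZl [LHS]sum4E.
by rewrite scalerA scaleNr mulrC addNr.
Qed.

Lemma inner_curvature_bpst b i j x :
  \sum_p inner (curvature (bpst b) i p x) (curvature (bpst b) j p x) =
  12 * conf x ^+ 4 * (i == j)%:R.
Proof.
under eq_bigr => p _ do rewrite !curvature_bpst innerZ.
by rewrite -mulr_sumr inner_wedge; ring.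
Qed.

End Instanton.

(** * Gauge covariance of the curvature *)

Section GaugeAlgebra.
Context {R : realType}.
Implicit Types (k a b d e f g : 'rV[R]_4).

(** The right side is the difference of the two mixed second derivatives of k that
one finds by differentiating d k = k b - a k; so their equality intertwines the
two curvatures. *)
Lemma gauge_curvature_algebra k ai aj bi bj dij dji eij eji :
  let dk a b := qmul k b - qmul a k in
  let ddk a b a' b' d e := qmul (dk a b) b' + qmul k e - (qmul d k + qmul a' (dk a b)) in
  qmul k (eij - eji + qbr bi bj) - qmul (dij - dji + qbr ai aj) k =
  ddk ai bi aj bj dij eij - ddk aj bj ai bi dji eji.
Proof.
move=> /=; rewrite /qbr !(qmulBl, qmulBr, qmulDl, qmulDr) !qmulA.
by apply/rowP => q; rewrite !(row_addE, row_oppE); ring.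
Qed.

Lemma gauge_cov_algebra k a b f g d e :
  qmul k g = qmul f k ->
  qmul (qmul k b - qmul a k) g + qmul k e = qmul d k + qmul f (qmul k b - qmul a k) ->
  qmul k (e + qbr b g) = qmul (d + qbr a f) k.
Proof.
move=> fg.
have akg : qmul (qmul a k) g = qmul (qmul a f) k by rewrite -!qmulA fg.
have fkb : qmul (qmul f k) b = qmul (qmul k g) b by rewrite fg.
rewrite /qbr !(qmulBl, qmulBr, qmulDl, qmulDr) !qmulA akg fkb => /rowP h.
by apply/rowP => q; move: (h q); rewrite !(row_addE, row_oppE); lra.
Qed.

End GaugeAlgebra.

(** The equation d k = k B - A k says that k carries the connection B to A. Being
    linear in k, it makes sense for k of any norm and B with a real part, and it
    is differentiated without inverting k. *)
Section GaugeCovariance.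
Context {R : realType}.
Variables (U : set 'rV[R]_4) (k : 'rV[R]_4 -> 'rV[R]_4) (A B : lform R).
Implicit Types (x y : 'rV[R]_4) (i j l : 'I_4).
Hypothesis oU : open U.
Hypothesis dk : forall x, U x -> differentiable k x.
Hypothesis dA : forall i x, U x -> differentiable (A i) x.
Hypothesis dB : forall i x, U x -> differentiable (B i) x.
Hypothesis gaugeE : forall i x, U x ->
  partial i k x = qmul (k x) (B i x) - qmul (A i x) (k x).

Let dkB i x : U x -> differentiable (fun y => qmul (k y) (B i y)) x.
Proof. by move=> Ux; apply: differentiable_qmul; [exact: dk|exact: dB]. Qed.

Let dAk i x : U x -> differentiable (fun y => qmul (A i y) (k y)) x.
Proof. by move=> Ux; apply: differentiable_qmul; [exact: dA|exact: dk]. Qed.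

Let dpk i x : U x -> differentiable (partial i k) x.
Proof.
move=> Ux; apply: (differentiable_on oU Ux (gaugeE i)).
exact: (differentiableB (dkB i Ux) (dAk i Ux)).
Qed.

(** The gauge equation makes the first derivatives of k differentiable, which is
all that the symmetry of second derivatives asks for. *)
Lemma gauge_curvature i j x : U x ->
  qmul (k x) (curvature B i j x) = qmul (curvature A i j x) (k x).
Proof.
move=> Ux; have := partialC oU Ux dk (dpk i Ux) (dpk j Ux).
have D m n : partial m (partial n k) x =
    qmul (qmul (k x) (B m x) - qmul (A m x) (k x)) (B n x) + qmul (k x) (partial m (B n) x)
    - (qmul (partial m (A n) x) (k x)
       + qmul (A n x) (qmul (k x) (B m x) - qmul (A m x) (k x))).
  rewrite (eq_partial_on m oU Ux (gaugeE n)) (partialB m (dkB n Ux) (dAk n Ux)).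
  rewrite (partial_qmul m (dk Ux) (dB n Ux)) (partial_qmul m (dA n Ux) (dk Ux)).
  by rewrite (gaugeE m Ux).
rewrite (D i j) (D j i) => /eqP; rewrite -subr_eq0 -gauge_curvature_algebra.
by rewrite subr_eq0 => /eqP.
Qed.

Hypothesis dFA : forall i j x, U x -> differentiable (curvature A i j) x.
Hypothesis dFB : forall i j x, U x -> differentiable (curvature B i j) x.

Lemma gauge_cov_curvature l i j x : U x ->
  qmul (k x) (partial l (curvature B i j) x + qbr (B l x) (curvature B i j x)) =
  qmul (partial l (curvature A i j) x + qbr (A l x) (curvature A i j x)) (k x).
Proof.
move=> Ux; have := eq_partial_on l oU Ux (gauge_curvature i j).
rewrite (partial_qmul l (dk Ux) (dFB i j Ux)) (partial_qmul l (dFA i j Ux) (dk Ux)).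
rewrite (gaugeE l Ux); exact: gauge_cov_algebra (gauge_curvature i j Ux).
Qed.

Lemma gauge_flat_div j x : U x ->
  qmul (k x) (flat_div B j x) = qmul (flat_div A j x) (k x).
Proof.
move=> Ux; rewrite /flat_div qmul_sumr qmul_suml.
by apply: eq_bigr => i _; exact: gauge_cov_curvature.
Qed.

End GaugeCovariance.

(** * Inversion, the change of charts *)

Section Inversion.
Context {R : realType}.
Implicit Types (x y : 'rV[R]_4) (i j l m : 'I_4).

Lemma open_punctured : open (punctured R).
Proof.
rewrite (_ : punctured R = ~` [set 0]); last first.
  by apply/seteqP; split=> x /eqP.
exact/closed_openC/accessible_closed_set1/hausdorff_accessible/norm_hausdorff.
Qed.

Lemma sqnorm_neq0 x : x != 0 -> sqnorm x != 0.
Proof. by rewrite sqnorm_eq0. Qed.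

Lemma sqnormZ (t : R) x : sqnorm (t *: x) = t ^+ 2 * sqnorm x.
Proof. by rewrite /sqnorm mulr_sumr; apply: eq_bigr => k _; rewrite mxE exprMn. Qed.

Lemma sqnorm_inversion x : x != 0 -> sqnorm (inversion x) = (sqnorm x)^-1.
Proof. by move=> /sqnorm_neq0 s0; rewrite sqnormZ expr2 -mulrA mulVf ?mulr1. Qed.

Lemma inversionK x : x != 0 -> inversion (inversion x) = x.
Proof.
move=> x0; rewrite {1}/inversion sqnorm_inversion// invrK /inversion scalerA.
by rewrite mulfV ?scale1r// sqnorm_neq0.
Qed.

Lemma inversion_neq0 x : x != 0 -> inversion x != 0.
Proof. by move=> x0; rewrite scaler_eq0 negb_or invr_eq0 sqnorm_neq0. Qed.

Lemma conf_inversion x : x != 0 -> conf (inversion x) = sqnorm x * conf x.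
Proof.
move=> x0; have s0 := sqnorm_neq0 x0.
have s1 : 1 + sqnorm x != 0 by rewrite gt_eqF// ltr_pwDl// sqnorm_ge0.
by rewrite /conf sqnorm_inversion//; field; rewrite s1 s0.
Qed.

Lemma differentiable_sqnormV x : x != 0 ->
  differentiable (fun y : 'rV[R]_4 => (sqnorm y)^-1 : R^o) x.
Proof.
by move=> x0; apply: (differentiableV (differentiable_sqnorm x)); exact: sqnorm_neq0.
Qed.

Lemma partial_sqnormV i x : x != 0 ->
  partial i (fun y => (sqnorm y)^-1 : R^o) x = - (2 * x 0 i * (sqnorm x)^-1 ^+ 2).
Proof.
move=> x0; rewrite (partialV i (differentiable_sqnorm x)); last exact: sqnorm_neq0.
by rewrite partial_sqnorm exprVn; ring.
Qed.

Lemma differentiable_inversion x : x != 0 -> differentiable (@inversion R) x.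
Proof.
by move=> x0; apply: differentiable_scale => //; exact: differentiable_sqnormV.
Qed.

Lemma partial_id i x : partial i id x = evec R i.
Proof. by rewrite partial_diff// diff_val. Qed.

Lemma partial_inversion i x : x != 0 ->
  partial i (@inversion R) x =
  (sqnorm x)^-1 *: evec R i - (2 * x 0 i * (sqnorm x)^-1 ^+ 2) *: x.
Proof.
move=> x0; rewrite (partialZ i (differentiable_sqnormV x0) (M := id)); last by [].
by rewrite partial_sqnormV// partial_id scaleNr addrC.
Qed.

Lemma JinvE x i j : x != 0 ->
  Jinv x i j = (sqnorm x)^-1 * (i == j)%:R - 2 * x 0 i * x 0 j * (sqnorm x)^-1 ^+ 2.
Proof.
move=> x0; rewrite mxE partial_inversion// row_addE row_oppE !row_scaleE evecE eq_sym.
by congr (_ - _); ring.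
Qed.

Lemma Jinv_sym x : x != 0 -> (Jinv x)^T = Jinv x.
Proof.
by move=> x0; apply/matrixP => i j; rewrite mxE !JinvE// eq_sym; congr (_ - _); ring.
Qed.

(** The Jacobian of the inversion is |x|^(-2) times the reflection in the
hyperplane orthogonal to x; so the Jacobian at the inverted point is its inverse,
and the inversion preserves the round metric. *)
Lemma Jinv_sqr x : x != 0 -> Jinv x *m Jinv x = ((sqnorm x)^-1 ^+ 2)%:M.
Proof.
move=> x0; have s0 := sqnorm_neq0 x0; set t := (sqnorm x)^-1.
have ts : t * sqnorm x = 1 by rewrite mulVf.
have JE : Jinv x = t%:M - (2 * t ^+ 2) *: (x^T *m x).
  apply/matrixP => i j; rewrite JinvE// !mxE big_ord1 !mxE -mulr_natr.
  by rewrite -/t; congr (_ - _); ring.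
have xx : x *m x^T = (sqnorm x)%:M.
  apply/matrixP => i j; rewrite !ord1 !mxE eqxx mulr1n.
  by apply: eq_bigr => k _; rewrite !mxE expr2.
have xxxx : x^T *m x *m (x^T *m x) = sqnorm x *: (x^T *m x).
  by rewrite mulmxA -[x^T *m x *m x^T]mulmxA xx mul_mx_scalar -scalemxAl.
rewrite JE mulmxBl !mulmxBr -!scalemxAr -!scalemxAl xxxx.
rewrite -scalar_mxM mul_scalar_mx mul_mx_scalar !scalerA -expr2.
have -> : 2 * t ^+ 2 * (2 * t ^+ 2) * sqnorm x = 2 * t ^+ 2 * t + 2 * t ^+ 2 * t.
  have -> : 2 * t ^+ 2 * (2 * t ^+ 2) * sqnorm x = 4 * t ^+ 3 * (t * sqnorm x) by ring.
  by rewrite ts; ring.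
by rewrite scalerDl opprB addrA -[RHS]addr0 -!addrA; congr (_ + _); rewrite !addrA addNr add0r subrr.
Qed.

Lemma Jinv_inversion x : x != 0 ->
  Jinv x *m Jinv (inversion x) = 1%:M.
Proof.
move=> x0; have s0 := sqnorm_neq0 x0; have ix0 := inversion_neq0 x0.
have -> : Jinv (inversion x) = sqnorm x ^+ 2 *: Jinv x.
  apply/matrixP => i j; rewrite [RHS]mxE !JinvE// sqnorm_inversion// invrK !row_scaleE.
  by field.
rewrite -scalemxAr Jinv_sqr// scale_scalar_mx.
by rewrite -exprMn mulfV// expr1n.
Qed.

Lemma partial_comp_inversion n (h : 'rV[R]_4 -> 'rV[R]_n) i x : x != 0 ->
  differentiable h (inversion x) ->
  differentiable (fun y => h (inversion y)) x /\
  partial i (fun y => h (inversion y)) x =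
  \sum_j Jinv x i j *: partial j h (inversion x).
Proof.
move=> x0 dh; have dI := differentiable_inversion x0.
have dc : differentiable (h \o @inversion R) x := differentiable_comp dI dh.
split=> //.
rewrite [LHS](partial_diff i dc) diff_comp//= -(partial_diff i dI).
rewrite [in LHS](row_sum_delta (partial i _ x)) linear_sum; apply: eq_bigr => j _.
by rewrite linearZ /= (partial_diff j dh) [Jinv x i j]mxE.
Qed.

(** The transformation law: the Jacobian J is symmetric with J^2 = |x|^(-4), and
f(x / |x|^2) = |x|^2 f(x). *)
Lemma round_is_metric (a : R) : a != 0 -> is_metric (round_metric a).
Proof.
move=> a0; split.
- exact: smooth_round.
- by move=> c x; rewrite round_metricE tr_scalar_mx.
- move=> c x v v0; rewrite round_metricE mul_mx_scalar -scalemxAl mxE.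
  have -> : (v *m v^T) 0 0 = sqnorm v.
    by rewrite mxE; apply: eq_bigr => k _; rewrite mxE expr2.
  rewrite mulr_gt0//; last by rewrite lt_neqAle sqnorm_ge0 eq_sym sqnorm_eq0 v0.
  apply: mulr_gt0; last by rewrite exprn_gt0// conf_gt0.
  by apply: mulr_gt0 => //; rewrite exprn_even_gt0.
- move=> x x0; rewrite Jinv_sym// !round_metricE conf_inversion//.
  rewrite mul_mx_scalar -scalemxAl Jinv_sqr// scale_scalar_mx; congr (_%:M).
  have s0 := sqnorm_neq0 x0; have := s0.
  by move: (sqnorm x) (conf x) => s f {}s0; field.
Qed.

End Inversion.

(** * The instanton near the projection point *)

Section InstantonPullback.
Context {R : realType}.
Implicit Types (x y p u : 'rV[R]_4) (i j l m : 'I_4).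

Lemma qmul_conjl p : qmul (qconj p) p = sqnorm p *: qone R.
Proof. by rewrite -{2}(qconjK p) qmul_conjr sqnorm_qconj. Qed.

Lemma imconj0 p : imconj p p = 0.
Proof. by rewrite /imconj qmul_conjl; apply: row4P; rewrite !quatE ?mulr0. Qed.

Lemma imconjDr p q u : imconj u (p + q) = imconj u p + imconj u q.
Proof. by rewrite /imconj; apply: row4P; rewrite !quatE; ring. Qed.
Lemma imconjZr (a : R) p u : imconj u (a *: p) = a *: imconj u p.
Proof. by rewrite /imconj; apply: row4P; rewrite !quatE; ring. Qed.

(** The pullback of the North instanton by the inversion is
Im(conj(y) dy) / (|y|^2 (1 + |y|^2)): the radial part of the Jacobian disappears
because conj(y) y is real. *)
Lemma bpst_pullback m y : y != 0 ->
  \sum_i Jinv y m i *: bpst false i (inversion y) =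
  (conf y * (sqnorm y)^-1) *: imconj y (evec R m).
Proof.
move=> y0; have s0 := sqnorm_neq0 y0; set t := (sqnorm y)^-1.
have JE : \sum_i Jinv y m i *: evec R i = t *: evec R m - (2 * y 0 m * t ^+ 2) *: y.
  rewrite -partial_inversion// [RHS]row_sum_delta.
  by apply: eq_bigr => i _; rewrite [Jinv y m i]mxE.
have termE i : Jinv y m i *: bpst false i (inversion y) =
    (conf y) *: (Jinv y m i *: imconj y (evec R i)).
  rewrite /bpst /= conf_inversion// {1}/inversion imconjZl !scalerA.
  by congr (_ *: _); field.
rewrite (eq_bigr _ (fun i _ => termE i)) -scaler_sumr.
have -> : \sum_i Jinv y m i *: imconj y (evec R i) =
    imconj y (\sum_i Jinv y m i *: evec R i).
  by rewrite [in RHS]sum4E !imconjDr !imconjZr [LHS]sum4E.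
by rewrite JE -scaleNr imconjDr !imconjZr imconj0 scaler0 addr0 scalerA.
Qed.

(** The real summand is d log|x|: closed and central, it does not contribute to the
curvature, and it accounts for the gauge function conj(x) not having norm one. *)
Definition south_model : lform R :=
  fun i x => bpst true i x + (x 0 i * (sqnorm x)^-1) *: qone R.

Lemma imconj_conjr p u : qmul (imconj p u) (qconj p) =
  inner p u *: qconj p - sqnorm p *: qconj u.
Proof.
by rewrite innerE sum4E sqnormE /imconj; apply: row4P; rewrite !quatE; ring.
Qed.

Lemma conj_imconj p u : qmul (qconj p) (imconj (qconj p) (qconj u)) =
  sqnorm p *: qconj u - inner p u *: qconj p.
Proof.
by rewrite innerE sum4E sqnormE /imconj; apply: row4P; rewrite !quatE; ring.
Qed.

(** Says that conj(y) is a gauge transformation from [south_model] to the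
pullback of the North instanton. Both sides are combinations of conj(y) and
conj(e_i), and 1 / |y|^2 - 1 / (1 + |y|^2) = 1 / (|y|^2 (1 + |y|^2)). *)
Lemma south_gauge_identity i y : y != 0 ->
  qmul ((conf y * (sqnorm y)^-1) *: imconj y (evec R i)) (qconj y) + qconj (evec R i) =
  qmul (qconj y) (south_model i y).
Proof.
move=> y0; have s0 := sqnorm_neq0 y0.
have s1 : 1 + sqnorm y != 0 by rewrite gt_eqF// ltr_pwDl// sqnorm_ge0.
rewrite /south_model /bpst /qflip qmulDr qmulZl imconj_conjr (qmulZr (conf y)) conj_imconj.
rewrite (qmulZr (_ / _)) qmul1r.
rewrite inner_evec /conf.
move: (sqnorm y) s0 s1 => s s0 s1.
apply/rowP => q; rewrite !(row_addE, row_oppE, row_scaleE).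
move: (qconj y 0 q) (qconj _ 0 q) => c d; field.
by rewrite s0 s1.
Qed.

Lemma qbr_addone p q (a b : R) : qbr (p + a *: qone R) (q + b *: qone R) = qbr p q.
Proof. by rewrite /qbr; apply: row4P; rewrite !quatE; ring. Qed.

Lemma qbr_addone_l p q (a : R) : qbr (p + a *: qone R) q = qbr p q.
Proof. by rewrite -[q in LHS]addr0 -(scale0r (qone R)) qbr_addone. Qed.

Lemma differentiable_radial i x : x != 0 ->
  differentiable (fun y : 'rV[R]_4 => y 0 i * (sqnorm y)^-1 : R^o) x.
Proof.
by move=> x0; exact: (differentiableM (differentiable_coord x 0 i) (differentiable_sqnormV x0)).
Qed.

Lemma partial_radial i j x : x != 0 ->
  partial i (fun y => y 0 j * (sqnorm y)^-1 : R^o) x = Jinv x i j.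
Proof.
move=> x0; rewrite (partialM i (differentiable_coord x 0 j) (differentiable_sqnormV x0)).
rewrite partial_coord partial_sqnormV// JinvE//; ring.
Qed.

Lemma differentiable_south_model i x : x != 0 -> differentiable (south_model i) x.
Proof.
move=> x0; apply: (differentiableD (differentiable_bpst true i x)).
by apply: differentiable_scale; [exact: differentiable_radial|].
Qed.

Lemma curvature_south_model i j x : x != 0 ->
  curvature south_model i j x = curvature (bpst true) i j x.
Proof.
move=> x0.
have p m n : partial m (south_model n) x = partial m (bpst true n) x + Jinv x m n *: qone R.
  have d : differentiable (fun y : 'rV[R]_4 => (y 0 n * (sqnorm y)^-1) *: qone R) x.
    by apply: differentiable_scale; [exact: differentiable_radial|].
  rewrite (partialD m (differentiable_bpst true n x) d); congr (_ + _).
  rewrite (partialZ m (differentiable_radial n x0)); last by [].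
  by rewrite partial_cst scaler0 addr0 partial_radial.
rewrite /curvature !p qbr_addone -{2}Jinv_sym// [(Jinv x)^T _ _]mxE.
have cancel (a b c q : 'rV[R]_4) : a + c - (b + c) + q = a - b + q.
  by rewrite opprD addrACA subrr addr0.
exact: cancel.
Qed.

Lemma flat_div_south_model j x : x != 0 -> flat_div south_model j x = 0.
Proof.
move=> x0; rewrite -(flat_div_bpst true j x) /flat_div; apply: eq_bigr => i _.
have -> : partial i (curvature south_model i j) x = partial i (curvature (bpst true) i j) x.
  by apply: (eq_partial_on i open_punctured x0) => y; exact: curvature_south_model.
by rewrite (curvature_south_model i j x0) qbr_addone_l.
Qed.

Lemma differentiable_curvature_bpst b i j x : differentiable (curvature (bpst b) i j) x.
Proof.
rewrite (_ : curvature _ i j = fun y => conf y ^+ 2 *: wedge (qflip b (evec R i)) (qflip b (evec R j))).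
  by apply: differentiable_scale; [exact: differentiable_confX|].
by apply/funext => y; exact: curvature_bpst.
Qed.

Lemma differentiable_curvature_south_model i j x : x != 0 ->
  differentiable (curvature south_model i j) x.
Proof.
move=> x0; apply: (differentiable_on open_punctured x0 _ (differentiable_curvature_bpst true i j x)).
by move=> y; exact: curvature_south_model.
Qed.

End InstantonPullback.

Section SmoothConnections.
Context {R : realType}.
Variable (A : lform R).
Hypothesis smA : forall i, smooth_on setT (A i).
Implicit Types (x y : 'rV[R]_4) (i j l m : 'I_4).

Lemma smooth_differentiable i x : differentiable (A i) x.
Proof. exact: (@smA i [::] x I). Qed.

Lemma smooth_differentiable1 i l x : differentiable (partial l (A i)) x.
Proof. exact: (@smA i [:: l] x I). Qed.

Lemma smooth_differentiable2 i l m x : differentiable (partial m (partial l (A i))) x.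
Proof. exact: (@smA i [:: m; l] x I). Qed.

Lemma differentiable_curvature i j x : differentiable (curvature A i j) x.
Proof.
apply: (differentiableD (differentiableB (smooth_differentiable1 j i x)
  (smooth_differentiable1 i j x))).
exact: differentiable_qbr (smooth_differentiable i x) (smooth_differentiable j x).
Qed.

Lemma partial_curvature l i j x : partial l (curvature A i j) x =
  partial l (partial i (A j)) x - partial l (partial j (A i)) x
  + (qbr (partial l (A i) x) (A j x) + qbr (A i x) (partial l (A j) x)).
Proof.
have d1 := smooth_differentiable1 j i x; have d2 := smooth_differentiable1 i j x.
have dq := differentiable_qbr (smooth_differentiable i x) (smooth_differentiable j x).
rewrite (partialD l (differentiableB d1 d2) dq) (partialB l d1 d2).
by rewrite (partial_qbr l (smooth_differentiable i x) (smooth_differentiable j x)).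
Qed.

Lemma differentiable_flat_div j x : differentiable (flat_div A j) x.
Proof.
rewrite (_ : flat_div A j = \sum_i (fun y => partial i (curvature A i j) y
    + qbr (A i y) (curvature A i j y))); last first.
  by apply/funext => y; rewrite fct_sumE.
apply: differentiable_sum => i.
apply: (differentiableD (g := fun y => qbr (A i y) (curvature A i j y))).
  rewrite (_ : partial i _ = fun y => partial i (partial i (A j)) y
    - partial i (partial j (A i)) y
    + (qbr (partial i (A i) y) (A j y) + qbr (A i y) (partial i (A j) y))).
    apply: (differentiableD (differentiableB (smooth_differentiable2 j i i x)
      (smooth_differentiable2 i j i x))).
    apply: (differentiableD
      (differentiable_qbr (smooth_differentiable1 i i x) (smooth_differentiable j x))).
    exact: differentiable_qbr (smooth_differentiable i x) (smooth_differentiable1 j i x).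
  by apply/funext => y; exact: partial_curvature.
exact: differentiable_qbr (smooth_differentiable i x) (differentiable_curvature i j x).
Qed.

Lemma continuous_curvature_inner i j : continuous
  (fun x => \sum_p inner (curvature A i p x) (curvature A j p x) : R^o).
Proof.
move=> x; apply: differentiable_continuous.
rewrite (_ : (fun x => _) = \sum_p \sum_k
  (fun x : 'rV[R]_4 => curvature A i p x 0 k * curvature A j p x 0 k : R^o)).
  apply: differentiable_sum => p; apply: differentiable_sum => k.
  have /differentiable_mxP/(_ 0 k) d1 := differentiable_curvature i p x.
  have /differentiable_mxP/(_ 0 k) d2 := differentiable_curvature j p x.
  exact: (differentiableM d1 d2).
apply/funext => y; rewrite fct_sumE; apply: eq_bigr => p _.
by rewrite fct_sumE innerE.
Qed.

End SmoothConnections.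

Section PuncturedContinuity.
Context {R : realType}.

(** The origin of the South chart is the one point of the sphere that the North
chart, hence the explicit formula for the connection, does not reach. *)
Lemma eq_at0_of_punctured (V : normedModType R) (f g : 'rV[R]_4 -> V) :
  {for 0, continuous f} -> {for 0, continuous g} ->
  (forall x, x != 0 -> f x = g x) -> f 0 = g 0.
Proof.
move=> cf cg fg.
pose line (t : R) : 'rV[R]_4 := t *: evec R 0.
have cl : line @ (0 : R)^' --> (0 : 'rV[R]_4).
  rewrite -[X in _ --> X](scale0r (evec R 0)).
  apply: cvg_within_filter.
  exact: scalel_continuous.
have fl : f \o line @ (0 : R)^' --> f 0 := cvg_comp _ _ cl cf.
have gl : g \o line @ (0 : R)^' --> g 0 := cvg_comp _ _ cl cg.
rewrite -(cvg_lim (@norm_hausdorff _ V) fl); apply: (cvg_lim (@norm_hausdorff _ V)).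
apply: cvg_trans gl; apply: near_eq_cvg.
near=> t; rewrite /=; apply/esym/fg.
rewrite /line scaler_eq0 negb_or; apply/andP; split.
  by near: t; exact: nbhs_dnbhs_neq.
by apply/eqP => /rowP/(_ 0)/eqP; rewrite evecE mxE eqxx oner_eq0.
Unshelve. all: by end_near. Qed.

End PuncturedContinuity.

Section SouthChart.
Context {R : realType}.
Variables (h : 'rV[R]_4 -> 'rV[R]_4) (A : connection R).
Hypothesis hE : is_SU2_bundle h.
Hypothesis hA : is_connection h A.
Hypothesis hinst : forall i x, A North i x = instanton i x.
Implicit Types (x y : 'rV[R]_4) (i j l m : 'I_4).

Let smA c i : smooth_on setT (A c i). Proof. by case: hA. Qed.

Lemma transition_conj x : x != 0 -> qmul (qconj (h x)) (h x) = qone R.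
Proof.
case: hE => _ hu /hu e; have s1 : sqnorm (h x) = 1.
  move: e; rewrite qmul_conjr => /(congr1 (fun p : 'rV[R]_4 => p 0 0)).
  by rewrite row_scaleE qone0E mulr1.
by rewrite qmul_conjl s1 scale1r.
Qed.

Lemma differentiable_transition x : x != 0 -> differentiable h x.
Proof. by case: hE => sm _; exact: (sm [::] x). Qed.

(** The transformation law of the connection, multiplied on the right by h and
solved for d h. *)
Lemma partial_transition i x : x != 0 ->
  partial i h x = qmul (h x) (bpst false i x)
    - \sum_j Jinv x i j *: qmul (A South j (inversion x)) (h x).
Proof.
move=> x0; case: hA => _ _ /(_ i x x0) /(congr1 (fun p => qmul p (h x))).
rewrite qmulBl -!qmulA transition_conj// !qmul1r hinst instantonE qmul_suml => e.
rewrite (eq_bigr (fun j => qmul (Jinv x i j *: A South j (inversion x)) (h x))).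
  by rewrite e opprB addrC subrK.
by move=> j _; rewrite qmulZl.
Qed.

(** The transition function, seen from the South chart, followed by the gauge
transformation conj(x) that removes the singularity of the pulled back
instanton. *)
Definition south_gauge x := qmul (h (inversion x)) (qconj x).

(** The same law pulled back to the South chart: the chain rule brings in the
Jacobian at y, which cancels the one at the inverted point. *)
Lemma partial_transition_inversion m y : y != 0 ->
  partial m (fun y => h (inversion y)) y =
  qmul (h (inversion y)) ((conf y * (sqnorm y)^-1) *: imconj y (evec R m))
  - qmul (A South m y) (h (inversion y)).
Proof.
move=> y0; have x0 := inversion_neq0 y0.
have [_ ->] := partial_comp_inversion m y0 (differentiable_transition x0).
rewrite -bpst_pullback// qmul_sumr.
under eq_bigr => i _ do rewrite partial_transition// inversionK// scalerBr.
rewrite sumrB; congr (_ - _).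
  by apply: eq_bigr => i _; rewrite qmulZr.
under eq_bigr => i _ do rewrite scaler_sumr.
rewrite exchange_big /=.
under eq_bigr => j _.
  under eq_bigr => i _ do rewrite scalerA.
  rewrite -scaler_suml.
  rewrite (_ : \sum_i _ = (1%:M : 'M[R]_4) m j); last by rewrite -(Jinv_inversion y0) [RHS]mxE.
  over.
by rewrite (sum_scalar_mx 1 (fun j => qmul (A South j y) (h (inversion y)))) scale1r.
Qed.

Lemma differentiable_qconj y : differentiable (@qconj R) y.
Proof.
apply: differentiable_row_linear => [p q|a p]; apply: row4P; rewrite !quatE; ring.
Qed.

Lemma partial_qconj i y : partial i (@qconj R) y = qconj (evec R i).
Proof.
apply: (@partial_row_linear _ 4) => [p q|a p]; apply: row4P; rewrite !quatE; ring.
Qed.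

Lemma differentiable_south_gauge y : y != 0 -> differentiable south_gauge y.
Proof.
move=> y0; have [d _] := partial_comp_inversion 0 y0 (differentiable_transition (inversion_neq0 y0)).
exact: differentiable_qmul d (differentiable_qconj y).
Qed.

Lemma partial_south_gauge i y : y != 0 ->
  partial i south_gauge y = qmul (south_gauge y) (south_model i y)
    - qmul (A South i y) (south_gauge y).
Proof.
move=> y0; have [d _] := partial_comp_inversion 0 y0 (differentiable_transition (inversion_neq0 y0)).
rewrite (partial_qmul i d (differentiable_qconj y)) partial_qconj.
rewrite partial_transition_inversion// qmulBl -!qmulA addrAC -qmulDr.
by rewrite south_gauge_identity// /south_gauge !qmulA.
Qed.

Lemma south_gauge_neq0 y : y != 0 -> south_gauge y != 0.
Proof.
move=> y0; rewrite -sqnorm_eq0 sqnorm_qmul sqnorm_qconj mulf_neq0 ?sqnorm_neq0//.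
apply/eqP => hz; have := transition_conj (inversion_neq0 y0); rewrite hz qmul0r.
by move/(congr1 (fun p : 'rV[R]_4 => p 0 0)) => /eqP; rewrite qone0E row_0E eq_sym oner_eq0.
Qed.

Let dA i x : punctured R x -> differentiable (A South i) x.
Proof. by move=> _; exact: smooth_differentiable (smA South) i x. Qed.

Lemma south_flat_div j x : flat_div (A South) j x = 0.
Proof.
have off y : y != 0 -> flat_div (A South) j y = 0.
  move=> y0; apply: qmul_eq0l (south_gauge_neq0 y0) _.
  have dFA i k z : punctured R z -> differentiable (curvature (A South) i k) z.
    by move=> _; exact: differentiable_curvature (smA South) i k z.
  have := gauge_flat_div open_punctured differentiable_south_gauge dA
    differentiable_south_model partial_south_gauge dFA
    differentiable_curvature_south_model j y0.
  by rewrite (flat_div_south_model j y0) qmul0r => /esym.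
have [->|/off//] := eqVneq x 0.
apply: (@eq_at0_of_punctured _ _ (flat_div (A South) j) (fun=> 0)) => //.
  exact/differentiable_continuous/differentiable_flat_div.
exact: cst_continuous.
Qed.

(** Multiplying by k on either side scales inner products by |k|^2, and this
factor cancels. *)
Lemma south_inner_curvature i j x :
  \sum_p inner (curvature (A South) i p x) (curvature (A South) j p x) =
  12 * conf x ^+ 4 * (i == j)%:R.
Proof.
have off y : y != 0 ->
    \sum_p inner (curvature (A South) i p y) (curvature (A South) j p y) =
    12 * conf y ^+ 4 * (i == j)%:R.
  move=> y0; rewrite -(inner_curvature_bpst true); apply: eq_bigr => p _.
  have k0 : sqnorm (south_gauge y) != 0 by rewrite sqnorm_neq0// south_gauge_neq0.
  have G a c : qmul (curvature (A South) a c y) (south_gauge y) =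
      qmul (south_gauge y) (curvature (bpst true) a c y).
    rewrite -(curvature_south_model a c y0); apply/esym.
    exact: gauge_curvature open_punctured differentiable_south_gauge dA
      differentiable_south_model partial_south_gauge a c y y0.
  apply: (mulfI k0); apply: etrans (esym (inner_qmulr _ _ _)) _.
  rewrite (G i p) (G j p).
  exact: inner_qmull.
have [->|/off//] := eqVneq x 0.
apply: (@eq_at0_of_punctured _ R^o
  (fun y => \sum_p inner (curvature (A South) i p y) (curvature (A South) j p y))
  (fun y => 12 * conf y ^+ 4 * (i == j)%:R)) => //.
  exact: continuous_curvature_inner (smA South) i j 0.
apply: differentiable_continuous.
apply: (differentiableM
  (differentiableM (differentiable_cst (12 : R^o) 0) (differentiable_confX 4 0))
  (differentiable_cst ((i == j)%:R : R^o) 0)).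
Qed.

End SouthChart.

(** * The soliton equations *)

Section RoundInstanton.
Context {R : realType}.
Variables (h : 'rV[R]_4 -> 'rV[R]_4) (A : connection R).
Hypothesis hE : is_SU2_bundle h.
Hypothesis hA : is_connection h A.
Hypothesis hinst : forall i x, A North i x = instanton i x.
Implicit Types (x y : 'rV[R]_4) (i j l m : 'I_4).

Lemma north_bpst : A North = bpst false.
Proof. by apply/funext => i; apply/funext => x; rewrite hinst instantonE. Qed.

Lemma flat_div_instanton c j x : flat_div (A c) j x = 0.
Proof.
case: c; first by rewrite north_bpst flat_div_bpst.
exact: south_flat_div hE hA hinst j x.
Qed.

Lemma inner_curvature_instanton c i j x :
  \sum_p inner (curvature (A c) i p x) (curvature (A c) j p x) =
  12 * conf x ^+ 4 * (i == j)%:R.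
Proof.
case: c; first by rewrite north_bpst inner_curvature_bpst.
exact: south_inner_curvature hE hA hinst i j x.
Qed.

Lemma Dstar_instanton a c j x : a != 0 -> Dstar (round_metric a c) (A c) j x = 0.
Proof. by move=> a0; rewrite Dstar_round// flat_div_instanton scaler0. Qed.

Lemma Zform_instanton a c x : a != 0 ->
  Zform (round_metric a c) (A c) x = (3 / (4 * a ^+ 4)) *: round_metric a c x.
Proof.
move=> a0; rewrite Zform_round// round_metricE scale_scalar_mx.
apply/matrixP => i j; rewrite !mxE inner_curvature_instanton -[RHS]mulr_natr mulrA.
congr (_ * _); have := conf_neq0 x; move: (conf x) => f f0.
by field; rewrite a0 f0.
Qed.

Lemma ricci_einstein a c x : a != 0 ->
  ricci (round_metric a c) x = (3 / a ^+ 2) *: round_metric a c x.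
Proof.
move=> a0; rewrite ricci_round// round_metricE scale_scalar_mx; congr (_%:M).
by field.
Qed.

Lemma round_soliton a : 0 < a ->
  coupled_soliton h (round_metric a) A (fun _ _ => 0) (fun _ _ => 0)
    (3 / (4 * a ^+ 4) * (8 * a ^+ 2 - 1)).
Proof.
move=> a_gt0; have a0 : a != 0 by rewrite gt_eqF.
have smooth0 n : smooth_on setT (fun=> 0 : 'rV[R]_n).
  apply: smooth_conf_poly => i j.
  rewrite (_ : (fun x => _) = fun=> 0); first exact: ConfPolyCst.
  by apply/funext => x; rewrite mxE.
split.
- split; [exact: round_is_metric|exact: hA| |].
  + by split=> [c|x x0]; [exact: smooth0|rewrite mul0mx].
  + split=> [c|c x|x x0]; [exact: smooth0|by rewrite /imaginary mxE|].
    by rewrite qmul0r qmul0l.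
- move=> c x; rewrite Zform_instanton// ricci_einstein// scalerA -scalerBl.
  have -> : lie_metric (fun=> 0) (round_metric a c) x = 0.
    have p m : partial m (fun=> 0 : 'rV[R]_4) x = 0 := partial_cst _ m x.
    apply/matrixP => i j; rewrite mxE [RHS]mxE big1// => k _.
    by rewrite !p !row_0E mul0r !mulr0 !addr0.
  rewrite subr0; congr (_ *: _).
  by field.
- move=> c j x; rewrite Dstar_instanton// /cov_section /lie_connection partial_cst.
  rewrite /qbr qmul0r qmul0l subr0 addr0 big1 ?subr0// => i _.
  by rewrite mxE scale0r.
Qed.

End RoundInstanton.

(** * From the flow to an ordinary differential equation *)

Section OneSidedDerivatives.
Context {R : realType}.
Implicit Types (J : set R) (f : R -> R) (t l : R).

(** Caratheodory's form replaces a limit of difference quotients by the continuity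
of a single factor q, which composes without excluding s = t; it serves endpoints
and interior points alike. *)
Lemma derive_within_caratheodory J f t l :
  is_derive_within J (f : R -> R^o) t l <->
  exists q : R -> R, [/\ forall s, J s -> f s - f t = q s * (s - t), q t = l
    & q s @[s --> within J (nbhs t)] --> l].
Proof.
split=> [dl|[q [fE qt ql]]].
  exists (fun s => if s == t then l else (s - t)^-1 * (f s - f t)); split.
  - move=> s _; case: eqVneq => [->|st]; first by rewrite !subrr mulr0.
    by rewrite mulrAC mulVf ?mul1r// subr_eq0.
  - by rewrite eqxx.
  - apply/cvgrPdist_lt => e e0; move/cvgrPdist_lt : dl => /(_ e e0).
    rewrite !near_withinE; apply: filterS => s /= hs Js.
    case: eqVneq => [_|st]; first by rewrite subrr normr0.
    exact: hs.
rewrite /is_derive_within.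
have qd : q s @[s --> within J (dnbhs t)] --> l.
  apply/cvgrPdist_lt => e e0; move/cvgrPdist_lt : ql => /(_ e e0).
  by rewrite !near_withinE; apply: filterS => s hs _; exact: hs.
apply: cvg_trans qd; apply: near_eq_cvg.
rewrite !near_withinE; near=> s => st Js.
rewrite fE// [RHS]/GRing.scale /= mulrCA mulVf ?mulr1//.
by rewrite subr_eq0.
Unshelve. all: by end_near. Qed.

Lemma derive_within_cvg J f t l :
  is_derive_within J (f : R -> R^o) t l -> f s @[s --> within J (nbhs t)] --> f t.
Proof.
move=> /derive_within_caratheodory[q [fE _ ql]].
have st : (s - t) @[s --> within J (nbhs t)] --> (0 : R).
  rewrite -[X in _ --> X](subrr t); apply: cvgB; last exact: cvg_cst.
  exact: cvg_within_filter.
have H : (q s * (s - t) + f t) @[s --> within J (nbhs t)] --> f t.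
  rewrite -[X in _ --> X]add0r -[X in X + _](mulr0 l).
  by apply: cvgD; [exact: cvgM|exact: cvg_cst].
apply: cvg_trans H; apply: near_eq_cvg.
by rewrite near_withinE; near=> s => Js; rewrite -fE// subrK.
Unshelve. all: by end_near. Qed.

Lemma derive_within_interior J f t l : nbhs t J ->
  is_derive_within J (f : R -> R^o) t l -> is_derive t 1 (f : R -> R^o) l.
Proof.
move=> tJ /derive_within_caratheodory[q [fE qt ql]].
apply/is_derive1_caratheodory.
exists (fun s => if s == t then l else (f s - f t) / (s - t)); split.
- move=> s; case: eqVneq => [->|st]; first by rewrite !subrr mulr0.
  by rewrite divfK// subr_eq0.
- rewrite /prop_for /continuous_at eqxx.
  have ql' : q s @[s --> t] --> l.
    move/cvgrPdist_lt : ql => ql; apply/cvgrPdist_lt => e /ql.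
    by rewrite near_withinE => h; apply: filterS2 h tJ => s h /h.
  apply: cvg_trans ql'; apply: near_eq_cvg.
  near=> s; case: eqVneq => [->//|st].
  rewrite fE ?mulfK ?subr_eq0//; near: s; exact: tJ.
- by rewrite eqxx.
Unshelve. all: by end_near. Qed.

End OneSidedDerivatives.

Section FlowReduction.
Context {R : realType}.
Variables (h : 'rV[R]_4 -> 'rV[R]_4) (A : connection R).
Hypothesis hE : is_SU2_bundle h.
Hypothesis hA : is_connection h A.
Hypothesis hinst : forall i x, A North i x = instanton i x.

Lemma rescale_round (b : R) : rescale (b ^+ 2) (round_metric 1) = round_metric b.
Proof.
apply/funext => c; apply/funext => x; rewrite /rescale !round_metricE scale_scalar_mx.
by congr (_%:M); ring.
Qed.

Lemma derive_within_scale J (f : R -> R) m n (M : 'M[R]_(m, n)) t l :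
  is_derive_within J (f : R -> R^o) t l ->
  is_derive_within J (fun s => f s *: M) t (l *: M).
Proof.
move=> dl; rewrite /is_derive_within.
have := cvg_comp _ _ dl (@scalel_continuous _ _ M l).
apply: cvg_trans; apply: near_eq_cvg; near=> s => /=.
by rewrite -scalerBl scalerA.
Unshelve. all: by end_near. Qed.

(** D^*F = 0 matches the constant connection. For the metric, both sides of the
flow equation are multiples of the unit round metric, and one nonzero entry of it
recovers the scalar equation. *)
Lemma coupled_flow_iff (J : set R) (kappa a : R -> R) :
  (forall t, J t -> 0 < a t) ->
  (coupled_flow h J kappa (fun t => rescale (a t ^+ 2) (round_metric 1)) (fun _ => A) <->
   forall t, J t -> is_derive_within J (fun s => a s ^+ 2 : R^o) t
     (- 6 + 3 * kappa t / (4 * a t ^+ 2))).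
Proof.
move=> a_gt0.
have velocity t c x : J t ->
    - 2 *: ricci (rescale (a t ^+ 2) (round_metric 1) c) x
    + kappa t *: Zform (rescale (a t ^+ 2) (round_metric 1) c) (A c) x =
    (- 6 + 3 * kappa t / (4 * a t ^+ 2)) *: round_metric 1 c x.
  move=> /a_gt0 at0; have a0 : a t != 0 by rewrite gt_eqF.
  rewrite rescale_round (ricci_einstein c x a0) (Zform_instanton hE hA hinst c x a0).
  rewrite -rescale_round /rescale !scalerA -scalerDl; congr (_ *: _).
  by field.
split=> [flow t Jt|ode t Jt].
  have [_ _ /(_ North 0) + _] := flow t Jt; rewrite velocity// /rescale.
  (* At the origin f = 1, so the unit round metric is 4 times the identity. *)
  have entry : round_metric 1 North (0 : 'rV[R]_4) 0 0 = 4.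
    rewrite round_metricE mxE eqxx mulr1n /conf.
    have /eqP -> : sqnorm (0 : 'rV[R]_4) == 0 by rewrite sqnorm_eq0.
    by rewrite addr0 invr1 !expr1n !mulr1.
  pose quarter (M : 'M[R]_4) : R^o := 4^-1 *: (M 0 0 : R^o).
  have cq : continuous quarter.
    move=> M; apply: (@continuous_comp _ _ _ (fun M : 'M[R]_4 => M 0 0 : R^o) ( *:%R 4^-1)).
      exact: coord_continuous.
    exact: scaler_continuous.
  have quarterE (b : R) : quarter (b *: round_metric 1 North 0) = b.
    by rewrite /quarter mxE entry /GRing.scale /=; field.
  move=> d; have := cvg_comp _ _ d (cq _); rewrite quarterE.
  apply: cvg_trans; apply: near_eq_cvg; near=> s => /=.
  by rewrite -scalerBl scalerA quarterE.
have at0 := a_gt0 t Jt; have a0 : a t != 0 by rewrite gt_eqF.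
split.
- by rewrite rescale_round; exact: round_is_metric.
- exact: hA.
- by move=> c x; rewrite velocity//; apply: derive_within_scale; exact: ode.
- move=> c j x; rewrite rescale_round (Dstar_instanton hE hA hinst c j x a0) oppr0.
  rewrite /is_derive_within; under eq_fun do rewrite subrr scaler0.
  exact: cvg_cst.
Unshelve. all: by end_near. Qed.

End FlowReduction.

(** * The radius equation *)

Section RadiusDecay.
Context {R : realType}.
Variables (c t0 : R) (y : R -> R).
Let J := [set t : R | t0 <= t].
Hypothesis c0 : 0 < c.
Hypothesis y0 : forall t, J t -> 0 < y t.
Hypothesis ode : forall t, J t ->
  is_derive_within J (y : R -> R^o) t (- 6 * (y t - c) / y t).

Lemma nincr_of_derive (f : R -> R) (df : R -> R) :
  {within `[t0, +oo[, continuous f} ->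
  (forall t, t0 < t -> is_derive t 1 (f : R -> R^o) (df t)) ->
  (forall t, t0 < t -> df t <= 0) -> forall t, t0 <= t -> f t <= f t0.
Proof.
move=> cf f' df0 t t0t; apply: (ler0_derive1_nincry _ _ cf (lexx t0) t0t).
  by move=> s; rewrite in_itv /= andbT => /f' [].
move=> s; rewrite in_itv /= andbT => t0s; rewrite derive1E.
by have [_ ->] := f' s t0s; exact: df0.
Qed.

Lemma derive_y t : t0 < t -> is_derive t 1 (y : R -> R^o) (- 6 * (y t - c) / y t).
Proof.
move=> t0t; apply: (derive_within_interior (J := J)); last by apply: ode; exact: ltW.
by apply: filterS (lt_nbhsr t0t) => s /ltW.
Qed.

(** The derivative of the left side is exp(r t) (r - 12 / y) (y - c)^2. The rate
r = 0 first yields the bound on y that a positive r requires. *)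
Lemma weighted_nincr (r : R) : (forall t, t0 < t -> r * y t <= 12) ->
  forall t, t0 <= t ->
  expR (r * t) * ((y t - c) * (y t - c)) <= expR (r * t0) * ((y t0 - c) * (y t0 - c)).
Proof.
move=> ry; apply: (nincr_of_derive
  (f := fun t => expR (r * t) * ((y t - c) * (y t - c)))
  (df := fun t => expR (r * t) * (r - 12 / y t) * ((y t - c) * (y t - c)))).
- have -> : [set` `[t0, +oo[%R] = J by apply/seteqP; split=> s; rewrite /= in_itv /= andbT.
  apply/subspace_continuousP => t Jt.
  have cy := derive_within_cvg (ode Jt).
  have cyc : (y s - c) @[s --> within J (nbhs t)] --> y t - c.
    by apply: cvgB => //; exact: cvg_cst.
  apply: cvgM; last exact: cvgM.
  apply: cvg_within_filter.
  apply: (@continuous_comp _ _ _ ( *%R r) expR); first exact: mulrl_continuous.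
  exact: continuous_expR.
- move=> s t0s; have dy := derive_y t0s.
  have dyc : is_derive s 1 ((fun t => y t - c) : R -> R^o) (- 6 * (y s - c) / y s).
    rewrite -[X in is_derive _ _ _ X]subr0.
    exact: (is_deriveB dy (is_derive_cst (c : R^o) s 1)).
  have dr : is_derive s 1 (( *%R r) : R -> R^o) r.
    have := is_deriveZ r (is_derive_id (s : R^o) 1).
    by rewrite [X in is_derive _ _ _ X]mulr1.
  have de : is_derive s 1 ((fun t => expR (r * t)) : R -> R^o) (expR (r * s) * r).
    exact: (is_derive1_comp (is_derive_expR (r * s)) dr).
  apply: (is_derive_eq (is_deriveM de (is_deriveM dyc dyc))).
  have ys : y s != 0 by rewrite gt_eqF// y0//; exact: ltW.
  have balance (e v u : R) : u != 0 ->
      e * (v * (- 6 * v / u) + v * (- 6 * v / u)) + v * v * (e * r) =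
      e * (r - 12 / u) * (v * v) by move=> u0; field.
  exact: balance.
- move=> s t0s; have ys : 0 < y s by apply: y0; exact: ltW.
  rewrite mulr_le0_ge0//; last by rewrite -expr2 sqr_ge0.
  rewrite mulr_ge0_le0 ?expR_ge0//.
  by rewrite subr_le0 ler_pdivlMr// ry.
Qed.

(** The bound M on y comes from |y - c| <= |y t0 - c|; the admissible rate
r = 12 / M concerns the square, so the distance decays at the rate 6 / M. *)
Lemma dist_decay : exists K r, [/\ 0 <= K, 0 < r &
  forall t, J t -> `|y t - c| <= K * expR (- r * t)].
Proof.
set d := `|y t0 - c|; pose M := c + d.
have d0 : 0 <= d by exact: normr_ge0.
have M0 : 0 < M by rewrite /M ltr_pwDl.
have dd t : t0 <= t -> `|y t - c| <= d.
  move=> t0t; rewrite -ler_sqr ?nnegrE// -!normrX !ger0_norm ?sqr_ge0//.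
  have := weighted_nincr (r := 0) _ t0t.
  by rewrite !mul0r expR0 !mul1r -!expr2; apply=> s _; rewrite mul0r.
have yM t : t0 <= t -> y t <= M.
  by move=> /dd; rewrite /M => h; have := ler_norm (y t - c); lra.
exists (d * expR (6 / M * t0)), (6 / M); split.
- by rewrite mulr_ge0// expR_ge0.
- by rewrite divr_gt0.
move=> t Jt; have := weighted_nincr (r := 12 / M) _ Jt.
rewrite -!expr2 => H.
have {}H : expR (12 / M * t) * (y t - c) ^+ 2 <= expR (12 / M * t0) * (y t0 - c) ^+ 2.
  apply: H => s t0s; rewrite mulrAC ler_pdivrMr// ler_pM2l//.
  by apply: yM; exact: ltW.
have half (s : R) : expR (12 / M * s) = expR (6 / M * s) ^+ 2.
  by rewrite expr2 -expRD; congr expR; field; rewrite gt_eqF.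
rewrite mulNr expRN ler_pdivlMr ?expR_gt0//.
rewrite -ler_sqr ?nnegrE ?mulr_ge0 ?expR_ge0//.
rewrite !exprMn -!half /d -!normrX !ger0_norm ?sqr_ge0//.
by rewrite mulrC [leRHS]mulrC.
Qed.

End RadiusDecay.

Section RadiusExistence.
Context {R : realType}.
Variables (c u0 t0 : R).
Let J := [set t : R | t0 <= t].
Hypothesis c0 : 0 < c.
Hypothesis cu0 : 0 < c + u0.

(** In terms of the new variable w the squared radius is [profile w], and the time
elapsed since t0 is [clock w] / 6; the radius equation becomes clock' = profile. *)
Definition profile (w : R) : R := c + u0 * expR (- w).
Definition clock (w : R) : R := c * w + u0 * (1 - expR (- w)).

Let min_rate := c + Num.min u0 0.

Lemma min_rate_gt0 : 0 < min_rate.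
Proof. by rewrite /min_rate; case: (ltP u0 0) => _; rewrite ?addr0. Qed.

Lemma profile_gt0 w : 0 <= w -> 0 < profile w.
Proof.
move=> w0; have e1 : expR (- w) <= 1 by rewrite -expR0 ler_expR oppr_le0.
have e0 := expR_gt0 (- w); rewrite /profile.
have [u_ge0|u_lt0] := leP 0 u0.
  by rewrite ltr_pwDl// mulr_ge0// ltW.
apply: (lt_le_trans cu0); rewrite lerD2l.
by rewrite -[leLHS]mulr1 ler_wnM2l// ltW.
Qed.

(** This bound from below makes w a Lipschitz function of time, in particular
continuous; [min_rate] is the infimum of [profile] over w >= 0. *)
Lemma clock_growth v w : 0 <= v -> v <= w -> min_rate * (w - v) <= clock w - clock v.
Proof.
move=> v0 vw.
have -> : clock w - clock v = c * (w - v) + u0 * (expR (- v) - expR (- w)).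
  by rewrite /clock; ring.
have lo : 0 <= expR (- v) - expR (- w) by rewrite subr_ge0 ler_expR lerN2.
have hi : expR (- v) - expR (- w) <= w - v.
  have -> : expR (- v) - expR (- w) = expR (- v) * (1 - expR (- (w - v))).
    by rewrite mulrBr mulr1 -expRD; congr (_ - expR _); ring.
  have e1 : expR (- v) <= 1 by rewrite -expR0 ler_expR oppr_le0.
  have := expR_ge1Dx (- (w - v)) => e2.
  have : 1 - expR (- (w - v)) <= w - v by lra.
  apply: le_trans; apply: ler_piMl => //.
  by rewrite subr_ge0 -expR0 ler_expR oppr_le0 subr_ge0.
rewrite /min_rate mulrDl lerD2l; have [u_lt0|u_ge0] := ltP u0 0.
  by rewrite ler_wnM2l// ltW.
by rewrite mul0r mulr_ge0.
Qed.

Lemma clock_lipschitz v w : 0 <= v -> 0 <= w ->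
  min_rate * `|w - v| <= `|clock w - clock v|.
Proof.
move=> v0 w0; wlog vw : v w v0 w0 / v <= w.
  move=> H; have [/H|/ltW/H] := leP v w; first exact.
  by rewrite distrC [`|clock v - _|]distrC; exact.
have g := clock_growth v0 vw.
rewrite (ger0_norm (x := w - v)) ?subr_ge0// ger0_norm//.
apply: le_trans g; rewrite mulr_ge0 ?subr_ge0//; exact/ltW/min_rate_gt0.
Qed.

Lemma derive_profile (w : R) : is_derive w 1 (profile : R -> R^o) (- (u0 * expR (- w))).
Proof.
have de : is_derive w 1 ((fun v => expR (- v)) : R -> R^o) (expR (- w) * - 1).
  exact: (is_derive1_comp (is_derive_expR (- w)) (is_deriveNid w 1)).
apply: (is_derive_eq (is_deriveD (is_derive_cst (c : R^o) w 1) (is_deriveZ u0 de))).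
by rewrite add0r /GRing.scale /= mulrN1 mulrN.
Qed.

Lemma derive_clock (w : R) : is_derive w 1 (clock : R -> R^o) (profile w).
Proof.
have -> : clock = (fun v => c * v + (c + u0 - profile v)).
  by apply/funext => v; rewrite /clock /profile; ring.
have dl : is_derive w 1 (( *%R c) : R -> R^o) c.
  have := is_deriveZ c (is_derive_id (w : R^o) 1).
  by rewrite [X in is_derive _ _ _ X]mulr1.
apply: (is_derive_eq (is_deriveD dl
  (is_deriveB (is_derive_cst (c + u0 : R^o) w 1) (derive_profile w)))).
by rewrite sub0r opprK.
Qed.

Lemma clock0 : clock 0 = 0.
Proof. by rewrite /clock oppr0 expR0 subrr !mulr0 addr0. Qed.

Lemma clock_surjective r : 0 <= r -> exists2 w, 0 <= w & clock w = r.
Proof.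
move=> r0; pose W := (r + `|u0|) / c.
have W0 : 0 <= W by rewrite divr_ge0 ?addr_ge0// ltW.
have clW : r <= clock W.
  rewrite /clock /W [c * _]mulrC divfK ?gt_eqF// -addrA lerDl.
  have e0 := expR_gt0 (- W); rewrite -/W.
  have e1 : expR (- W) <= 1 by rewrite -expR0 ler_expR oppr_le0.
  have : - `|u0| * (1 - expR (- W)) <= u0 * (1 - expR (- W)).
    by rewrite ler_wpM2r ?subr_ge0// lerNnormlW.
  have := normr_ge0 u0; nra.
have cont : {within `[0, W], continuous clock}.
  by apply: derivable_within_continuous => s _; have [] := derive_clock s.
have between : Num.min (clock 0) (clock W) <= r <= Num.max (clock 0) (clock W).
  by rewrite clock0 ge_min r0 /= le_max clW orbT.
have [w] := IVT W0 cont between.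
by rewrite in_itv /= => /andP[w0 _] cw; exists w.
Qed.

(** From 6 (s - t) = clock(w s) - clock(w t) = q(w s) (w s - w t), with q the
Caratheodory factor of the clock, the factor of y at t is 6 p / q, with p that of
the profile; here q has the limit profile(w t) > 0. *)
Lemma radius_existence : exists y : R -> R,
  [/\ forall t, J t -> 0 < y t, y t0 = c + u0 &
   forall t, J t -> is_derive_within J (y : R -> R^o) t (- 6 * (y t - c) / y t)].
Proof.
have ex t : exists w, J t -> 0 <= w /\ clock w = 6 * (t - t0).
  have [Jt|nJt] := pselect (J t); last by exists 0.
  have [|w w0 cw] := @clock_surjective (6 * (t - t0)); last by exists w.
  by rewrite mulr_ge0// subr_ge0.
have /choice[w wP] := ex.
have w0 t : J t -> 0 <= w t by case/wP.
have cw t : J t -> clock (w t) = 6 * (t - t0) by case/wP.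
have Jt0 : J t0 by exact: lexx.
have wt0 : w t0 = 0.
  have := clock_lipschitz (lexx 0) (w0 _ Jt0).
  rewrite cw// clock0 subrr mulr0 !subr0 normr0.
  by rewrite pmulr_rle0 ?min_rate_gt0// normr_le0 => /eqP.
exists (fun t => profile (w t)); split=> [t /w0|| t Jt].
- exact: profile_gt0.
- by rewrite wt0 /profile oppr0 expR0 mulr1.
have yt := profile_gt0 (w0 t Jt).
have /is_derive1_caratheodory[q [qE qc qt]] := derive_clock (w t).
have /is_derive1_caratheodory[p [pE pc pt]] := derive_profile (w t).
have wc : w s @[s --> within J (nbhs t)] --> w t.
  apply/cvgrPdist_lt => e e0; rewrite near_withinE.
  have d0 : 0 < min_rate * e / 6 by rewrite divr_gt0// mulr_gt0// min_rate_gt0.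
  have close : \forall s \near t, `|t - s| < min_rate * e / 6.
    exact: (cvgrPdist_lt _ _).1 (@cvg_id _ (nbhs t)) _ d0.
  apply: filterS close => s ts Js.
  have := clock_lipschitz (w0 s Js) (w0 t Jt); rewrite !cw//.
  have -> : 6 * (t - t0) - 6 * (s - t0) = 6 * (t - s) by ring.
  rewrite normrM ger0_norm// => H.
  rewrite -(ltr_pM2l min_rate_gt0); apply: (le_lt_trans H).
  by rewrite mulrC -ltr_pdivlMr.
(* The growth bound forbids q to vanish away from w t, and q (w t) = profile (w t). *)
have q0 s : J s -> q (w s) != 0.
  move=> Js; have [e|ne] := eqVneq (w s) (w t); first by rewrite e qt gt_eqF.
  apply/eqP => qz; have := clock_lipschitz (w0 t Jt) (w0 s Js).
  rewrite qE qz mul0r normr0 leNgt => /negP; apply.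
  by rewrite mulr_gt0 ?min_rate_gt0// normr_gt0 subr_eq0.
apply/derive_within_caratheodory.
exists (fun s => 6 * p (w s) / q (w s)); split.
- move=> s Js; rewrite pE; have := qE (w s); rewrite !cw// => h.
  have st : s - t = q (w s) * (w s - w t) / 6.
    by rewrite -h; field.
  by rewrite st; field; exact: q0.
- rewrite pt qt; congr (_ / _); rewrite /profile; ring.
- have pw : p (w s) @[s --> within J (nbhs t)] --> p (w t) := cvg_comp _ _ wc pc.
  have qw : q (w s) @[s --> within J (nbhs t)] --> q (w t) := cvg_comp _ _ wc qc.
  have -> : - 6 * (profile (w t) - c) / profile (w t) = 6 * p (w t) / q (w t).
    by rewrite pt qt; congr (_ / _); rewrite /profile; ring.
  apply: cvgM; first by apply: cvgM => //; exact: cvg_cst.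
  by apply: cvgV => //; rewrite qt gt_eqF.
Qed.

End RadiusExistence.

Section Convergence.
Context {R : realType}.

Lemma eq_derive_within (J : set R) (f g : R -> R) t l : J t ->
  (forall s, J s -> f s = g s) ->
  is_derive_within J (f : R -> R^o) t l -> is_derive_within J (g : R -> R^o) t l.
Proof.
move=> Jt fg /derive_within_caratheodory[q [fE qt ql]].
apply/derive_within_caratheodory; exists q; split=> // s Js.
by rewrite -!fg// fE.
Qed.

Lemma radius_rate (kappa y : R) : y != 0 ->
  - 6 + 3 * kappa / (4 * y) = - 6 * (y - kappa / 8) / y.
Proof. by move=> y0; field. Qed.

(** Convergence of a^2 passes to a because a + l >= l. *)
Lemma sqrt_dist_le (a l : R) : 0 < a -> 0 < l ->
  `|a - l| <= `|a ^+ 2 - l ^+ 2| / l.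
Proof.
move=> a0 l0; rewrite ler_pdivlMr// subr_sqr normrM ler_wpM2l//.
by rewrite gtr0_norm ?addr_gt0// lerDr ltW.
Qed.

Lemma radius_convergence (kappa t0 : R) (a : R -> R) : 0 < kappa ->
  let J := [set t : R | t0 <= t] in
  (forall t, J t -> 0 < a t) ->
  (forall t, J t -> is_derive_within J (fun s => a s ^+ 2 : R^o) t
     (- 6 + 3 * kappa / (4 * a t ^+ 2))) ->
  exists C lambda, [/\ 0 < C, 0 < lambda & forall t, J t ->
    `|a t - Num.sqrt (kappa / 8)| <= C * expR (- lambda * t)].
Proof.
move=> k0 J a0 ode.
have c0 : 0 < kappa / 8 by rewrite divr_gt0.
have y0 t : J t -> 0 < a t ^+ 2 by move=> Jt; rewrite exprn_gt0// a0.
have ode' t : J t -> is_derive_within J (fun s => a s ^+ 2 : R^o) t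
    (- 6 * (a t ^+ 2 - kappa / 8) / a t ^+ 2).
  by move=> Jt; rewrite -radius_rate ?gt_eqF ?y0//; exact: ode.
have [K [r [K0 r0 decay]]] := dist_decay c0 y0 ode'.
have l0 : 0 < Num.sqrt (kappa / 8) by rewrite sqrtr_gt0.
(* The decay estimate allows K = 0, and the constant has to be positive. *)
exists (K / Num.sqrt (kappa / 8) + 1), r; split=> // [|t Jt].
  by rewrite ltr_wpDl// divr_ge0// ltW.
have l2 : Num.sqrt (kappa / 8) ^+ 2 = kappa / 8 by rewrite sqr_sqrtr ?ltW.
have := sqrt_dist_le (a0 t Jt) l0; rewrite l2; move: (Num.sqrt _) l0 => l l0 H.
apply: (le_trans H); rewrite ler_pdivrMr//; apply: (le_trans (decay t Jt)).
rewrite mulrAC ler_wpM2r ?expR_ge0// mulrDl mul1r divfK ?gt_eqF//.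
by rewrite lerDl ltW.
Qed.

End Convergence.

(** * The theorem *)

Theorem theorem3p4 (R : realType) (E : 'rV[R]_4 -> 'rV[R]_4)
    (hE : is_SU2_bundle E) (hc2 : c2_is E 1)
    (A1 : connection R) (hA1 : is_connection E A1)
    (hinst : forall i x, A1 North i x = instanton i x) :
  (forall a : R, 0 < a ->
    [/\ 8^-1 < a ^+ 2 -> shrinking_soliton E (round_metric a) A1,
        a ^+ 2 = 8^-1 -> steady_soliton E (round_metric a) A1
      & a ^+ 2 < 8^-1 -> expanding_soliton E (round_metric a) A1])
  /\
  (forall (J : set R) (kappa a : R -> R),
    is_interval J -> (exists s t, [/\ J s, J t & s < t]) ->
    smooth_within J kappa -> (forall t, J t -> 0 < kappa t) ->
    (forall t, J t -> 0 < a t) ->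
    (coupled_flow E J kappa (fun t => rescale (a t ^+ 2) (round_metric 1))
       (fun _ => A1) <->
     forall t, J t ->
       is_derive_within J (fun s => a s ^+ 2 : R^o) t
         (- 6 + 3 * kappa t / (4 * a t ^+ 2))))
  /\
  (forall kappa t0 : R, 0 < kappa ->
    let J := [set t : R | t0 <= t] in
    let solution (a : R -> R) :=
      (forall t, J t -> 0 < a t) /\
      coupled_flow E J (fun _ => kappa)
        (fun t => rescale (a t ^+ 2) (round_metric 1)) (fun _ => A1) in
    (forall a0, 0 < a0 -> exists a, solution a /\ a t0 = a0) /\
    (forall a, solution a ->
      exists C lambda, [/\ 0 < C, 0 < lambda & forall t, J t ->
        `|a t - Num.sqrt (kappa / 8)| <= C * expR (- lambda * t)])).
Proof.
split; [|split].
- move=> a a0; have a2 : 0 < a ^+ 2 by rewrite exprn_gt0.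
  have pre : 0 < 3 / (4 * a ^+ 4) by rewrite divr_gt0// mulr_gt0// exprn_gt0.
  (* X and omega are zero; only the sign of rho depends on a. *)
  have sol := round_soliton hE hA1 hinst a0.
  split=> ha; exists (fun _ _ => 0), (fun _ _ => 0), (3 / (4 * a ^+ 4) * (8 * a ^+ 2 - 1));
    split=> //.
  + by rewrite mulr_gt0//; lra.
  + by rewrite ha divff// subrr mulr0.
  + by rewrite pmulr_rlt0//; lra.
- move=> J kappa a _ _ _ _ a0; exact: coupled_flow_iff.
- move=> kappa t0 k0 J solution; split.
    move=> a0 a00; have c0 : 0 < kappa / 8 by rewrite divr_gt0.
    have cu : 0 < kappa / 8 + (a0 ^+ 2 - kappa / 8) by rewrite addrC subrK exprn_gt0.
    have [y [y0 yt0 ode]] := radius_existence t0 c0 cu.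
    have sq t : J t -> Num.sqrt (y t) ^+ 2 = y t by move=> Jt; rewrite sqr_sqrtr// ltW// y0.
    have pos t : J t -> 0 < Num.sqrt (y t) by move=> Jt; rewrite sqrtr_gt0 y0.
    exists (fun t => Num.sqrt (y t)); split; last first.
      by rewrite yt0 addrC subrK sqrtr_sqr ger0_norm// ltW.
    split=> //; apply/(coupled_flow_iff hE hA1 hinst) => // t Jt.
    rewrite sq// radius_rate ?gt_eqF ?y0//.
    by apply: eq_derive_within (ode t Jt) => // s /sq.
  move=> a [a0 flow]; apply: radius_convergence => //.
  exact: (coupled_flow_iff hE hA1 hinst (fun=> kappa) a0).1.
Qed.
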